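(* For each $k\in\{2,3,4,5\}$, the algebra $H_k$ is a free $R_k$-module of rank $|W_k|$.
   Context: Let $B_3=\langle s_1,s_2\mid s_1s_2s_1=s_2s_1s_2\rangle$ be the braid group on 3 strands. For $k\in\{2,3,4,5\}$ let $R_k=\mathbb{Z}[a_{k-1},\dots,a_1,a_0,a_0^{-1}]$ (polynomial ring over $\mathbb{Z}$ in indeterminates $a_{k-1},\dots,a_0$, with $a_0$ inverted), and let $H_k$ be the quotient of the group algebra $R_kB_3$ by the relations $s_i^k=a_{k-1}s_i^{k-1}+\dots+a_1s_i+a_0$ for $i=1,2$. Let $W_k$ be the quotient group of $B_3$ by the normal subgroup generated by $s_1^k$ and $s_2^k$; it is a finite group (namely $\mathfrak{S}_3$, $G_4$, $G_8$, $G_{16}$ for $k=2,3,4,5$, of orders $6,24,96,600$). *)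

(* Defs.v *)
From HB Require Import structures.
From mathcomp Require Import all_boot all_order all_algebra.
From mathcomp Require Import fraction.
From mathcomp Require Import mpoly.
Set Implicit Arguments. Unset Strict Implicit. Unset Printing Implicit Defensive.
Import Order.TTheory GRing.Theory.
Local Open Scope ring_scope.

(* Coefficient ring R_k = Z[a_{k-1},...,a_1,a_0,a_0^{-1}].                   *)
(* We realise it as the subring of the fraction field                        *)
(*   Frac k := Frac(Z[a_0,...,a_{k-1}]),  a_j := 'X_j,                       *)
(* consisting of the elements p / a_0^m with p a polynomial.                 *)

Definition Poly (k : nat) := {mpoly int[k]}.
Definition FracR (k : nat) := {fraction Poly k}.

Definition param (k : nat) (j : 'I_k) : FracR k := tofrac ('X_j : Poly k).

Definition inRk (k : nat) (x : FracR k) : Prop :=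
  exists (p : Poly k) (m : nat), forall j0 : 'I_k, val j0 = 0%N ->
    x = tofrac p / (param j0) ^+ m.

(* Free associative algebra over a commutative ring R on the 4 letters       *)
(*   0 = s_1, 1 = s_2, 2 = s_1^{-1}, 3 = s_2^{-1},                           *)
(* with elements given as formal finite sums of (coefficient, word).         *)
(* Two formal sums denote the same element iff their coefficient functions  *)
(* agree.                                                                    *)
Definition word := seq 'I_4.
Definition fsum (R : Type) := seq (R * word).

Section FreeAlg.
Variable R : comNzRingType.

Definition coef (p : fsum R) (w : word) : R :=
  \sum_(t <- p | t.2 == w) t.1.

Definition fsum_eq (p q : fsum R) : Prop := forall w, coef p w = coef q w.

Definition fmul (p q : fsum R) : fsum R :=
  [seq (t.1 * u.1, t.2 ++ u.2) | t <- p, u <- q].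
Definition fscale (c : R) (p : fsum R) : fsum R := [seq (c * t.1, t.2) | t <- p].
Definition fadd (p q : fsum R) : fsum R := p ++ q.
Definition fsub (p q : fsum R) : fsum R := p ++ fscale (-1) q.
Definition fword (w : word) : fsum R := [:: (1, w)].
Definition fone : fsum R := fword [::].
Definition flin (N : nat) (c : 'I_N -> R) (b : 'I_N -> fsum R) : fsum R :=
  flatten [seq fscale (c i) (b i) | i <- enum 'I_N].

Variable S : R -> Prop.  (* the coefficient subring *)

Definition coefs_in (p : fsum R) : Prop := forall t, t \in p -> S t.1.

Definition in_ideal (rels : seq (fsum R)) (p : fsum R) : Prop :=
  exists l : seq (R * word * fsum R * word),
    (forall x, x \in l -> S x.1.1.1 /\ x.1.2 \in rels) /\
    fsum_eq p (flatten [seq fscale x.1.1.1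
                        (fmul (fword x.1.1.2) (fmul x.1.2 (fword x.2))) | x <- l]).

Definition quotient_free_of_rank (rels : seq (fsum R)) (N : nat) : Prop :=
  exists b : 'I_N -> fsum R,
    (forall i, coefs_in (b i)) /\
    (forall p, coefs_in p ->
       exists c : 'I_N -> R, (forall i, S (c i)) /\
         in_ideal rels (fsub p (flin c b))) /\
    (forall c : 'I_N -> R, (forall i, S (c i)) ->
       in_ideal rels (flin c b) -> forall i, c i = 0).

End FreeAlg.

(* The algebra H_k.                                                          *)
(* R_k B_3 = R_k<s1,s2,s1^-1,s2^-1> / (s_i s_i^-1 - 1, s_i^-1 s_i - 1,        *)
(*                                     s1 s2 s1 - s2 s1 s2),                 *)
(* and H_k adds  s_i^k - (a_{k-1} s_i^{k-1} + ... + a_1 s_i + a_0).          *)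
Definition l1 : 'I_4 := inord 0.
Definition l2 : 'I_4 := inord 1.
Definition l1i : 'I_4 := inord 2.
Definition l2i : 'I_4 := inord 3.

Definition hecke_rel (k : nat) (l : 'I_4) : fsum (FracR k) :=
  fsub (fword _ (nseq k l))
       [seq (param j, nseq (val j) l) | j <- enum 'I_k].

Definition Hk_rels (k : nat) : seq (fsum (FracR k)) :=
  [:: fsub (fword _ [:: l1; l1i]) (fone _);
      fsub (fword _ [:: l1i; l1]) (fone _);
      fsub (fword _ [:: l2; l2i]) (fone _);
      fsub (fword _ [:: l2i; l2]) (fone _);
      fsub (fword _ [:: l1; l2; l1]) (fword _ [:: l2; l1; l2]);
      hecke_rel k l1;
      hecke_rel k l2].

(* |W_k| for k = 2,3,4,5  (S_3, G_4, G_8, G_16) *)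
Definition W_order (k : nat) : nat :=
  match k with 2 => 6 | 3 => 24 | 4 => 96 | 5 => 600 | _ => 0 end.

(* Main.v *)
(* Write a = s1, b = s2, u = R[a], and let z = (ab)^3 be the central element of B_3.

   Spanning.  Let U be the R-span of finitely many u-bimodules z^m u g u with g among 1, b, b^2,
   b^2 a^-1 b.  For braids x, y the k + 1 elements x a^n y (0 <= n <= k) satisfy a linear relation
   whose two extreme coefficients are units of R; so if all of them but an extreme one lie in U,
   so does the last one.  Starting from the generators of U, a finite chain of such deductions shows
   that b U is contained in U, hence that U is all of H_k.  Braids are compared through their
   Garside normal forms, up to powers of a on both sides.

   Independence.  The chosen words represent distinct elements of W_k.  Every irreducible
   representation of W_k over an algebraically closed field of characteristic 0 deforms, modulo t^M,
   along a curve of parameters starting at X^k - 1: the braid relation is equivalent to A^2 = B^3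
   for A = aba, B = ab; one keeps A^2 scalar, conjugates B, and prescribes the eigenvalues of
   a = B^-1 A.  At each order the obstruction is the trace of one matrix (the commutators with
   B and a span the matrices of trace zero, by Schur's lemma), and it vanishes because the
   determinants agree.  If the coefficients of a linear relation between the words are not all 0,
   choose the curve so that one of them does not vanish along it; the lowest order term
   in t then yields a nontrivial linear relation between elements of W_k in its group algebra. *)
From Stdlib Require Import ZArith ClassicalEpsilon.
From HB Require Import structures.
From mathcomp Require Import all_boot all_order all_fingroup all_algebra.
From mathcomp Require Import all_solvable all_field all_character.
From mathcomp Require Import fraction mpoly qpoly ring.
Require Import Defs.
Set Implicit Arguments. Unset Strict Implicit. Unset Printing Implicit Defensive.
Import Order.TTheory GRing.Theory Num.Theory.
Local Open Scope ring_scope.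

(** * Deformation of braid representations *)

(** In the Leibniz formula a permutation other than the identity moves both some i and its image p
    i, so its term contains two off-diagonal entries, each divisible by s. *)
Lemma det_addmx_scale (R : comNzRingType) d (s : R) (F : 'M[R]_d) :
  exists q, \det (1%:M + s *: F) = 1 + s * \tr F + s ^+ 2 * q.
Proof.
rewrite /determinant (bigD1 (1%g : 'S_d)) //= odd_perm1 expr0 mul1r.
have prod_diag (I : seq 'I_d) : exists q, \prod_(i <- I) (1%:M + s *: F) i i
    = 1 + s * (\sum_(i <- I) F i i) + s ^+ 2 * q.
  elim: I => [|i I [q IH]]; first by exists 0; rewrite !big_nil !mulr0 !addr0.
  exists (q + F i i * (\sum_(i <- I) F i i) + F i i * s * q).
  by rewrite !big_cons IH !mxE eqxx /= mulr1n; ring.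
have [q Hq] := prod_diag (index_enum 'I_d).
have -> : \prod_(i < d) (1%:M + s *: F) i ((1 : 'S_d)%g i) =
   \prod_(i < d) (1%:M + s *: F) i i by apply: eq_bigr => i _; rewrite perm1.
rewrite Hq.
suff [r ->] : exists r, \sum_(i : 'S_d | i != 1%g)
    (-1) ^+ i * \prod_(i0 < d) (1%:M + s *: F) i0 (i i0) = s ^+ 2 * r.
  by exists (q + r); rewrite mulrDr addrA.
apply: (big_ind (fun x => exists r, x = s ^+ 2 * r)).
- by exists 0; rewrite mulr0.
- by move=> x y [r1 ->] [r2 ->]; exists (r1 + r2); rewrite mulrDr.
move=> p pn1.
have [i pi] : exists i, p i != i.
  apply/existsP; apply: contraNT pn1 => /existsPn h.
  by apply/eqP/permP => i; rewrite perm1; apply/eqP; rewrite -[_ == _]negbK h.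
have pi2 : p (p i) != p i by apply: contra pi => /eqP/perm_inj ->.
rewrite (bigD1 i) //= (bigD1 (p i)) //=.
have offd j : p j != j -> (1%:M + s *: F) j (p j) = s * F j (p j).
  by move=> nj; rewrite !mxE eq_sym (negPf nj) add0r.
rewrite !offd //.
set P := \prod_(_ < d | _) _.
exists ((-1) ^+ p * (F i (p i) * F (p i) (p (p i)) * P)).
by move: ((-1) ^+ p) (F i _) (F (p i) _) P => x y u v; ring.
Qed.

Section MatrixPowers.
Variables (R : comUnitRingType) (d : nat).
Lemma conjmx_exp (U X : 'M[R]_d) n : U \in unitmx ->
  (U *m X *m invmx U) ^+ n = U *m X ^+ n *m invmx U.
Proof.
move=> Uu; elim: n => [|n IH]; first by rewrite !expr0 mulmx1 mulmxV.
by rewrite !exprS IH -!mulmxE !mulmxA mulmxKV.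
Qed.

Lemma diag_mx_exp (e : 'rV[R]_d) n : diag_mx e ^+ n = diag_mx (map_mx (fun a => a ^+ n) e).
Proof.
elim: n => [|n IH].
  by apply/matrixP=> i j; rewrite expr0 !mxE; case: eqP.
rewrite exprS IH -mulmxE mulmx_diag; congr diag_mx.
by apply/rowP=> i; rewrite !mxE exprS.
Qed.

Lemma diag_conj_root k (c : 'I_k -> R) (U : 'M[R]_d) (e : 'rV[R]_d) : U \in unitmx ->
  (forall i, e 0 i ^+ k = \sum_(j < k) c j * e 0 i ^+ j) ->
  (U *m diag_mx e *m invmx U) ^+ k =
  \sum_(j < k) c j *: (U *m diag_mx e *m invmx U) ^+ j.
Proof.
move=> Uu he; rewrite conjmx_exp // diag_mx_exp.
under eq_bigr do rewrite conjmx_exp // diag_mx_exp scalemxAl scalemxAr.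
rewrite -mulmx_suml -mulmx_sumr; congr (_ *m _ *m _).
apply/matrixP=> i j; rewrite summxE !mxE.
under eq_bigr do rewrite !mxE.
case: (i == j); last by rewrite mulr0n big1 // => l _; rewrite mulr0n mulr0.
by rewrite mulr1n he; apply: eq_bigr => l _; rewrite mulr1n.
Qed.

Lemma invmx_mul (U V : 'M[R]_d) : U \in unitmx -> V \in unitmx ->
  invmx (U *m V) = invmx V *m invmx U.
Proof.
move=> Uu Vu; have UVu : U *m V \in unitmx by rewrite unitmx_mul Uu.
by apply: (can_inj (mulKmx UVu)); rewrite mulmxV // mulmxA mulmxK // mulmxV.
Qed.

Lemma conjmx_conj (U V X : 'M[R]_d) : U \in unitmx -> V \in unitmx ->
  U *m (V *m X *m invmx V) *m invmx U = U *m V *m X *m invmx (U *m V).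
Proof. by move=> Uu Vu; rewrite invmx_mul // !mulmxA. Qed.

Lemma conjmx_cube (U X : 'M[R]_d) a : U \in unitmx -> X *m X *m X = a%:M ->
  let c := U *m X *m invmx U in c *m c *m c = a%:M.
Proof.
move=> Uu X3 c; have -> : c *m c *m c = U *m (X *m X *m X) *m invmx U.
  by rewrite /c !mulmxA !mulmxKV.
by rewrite X3 scalar_mxC -mulmxA mulmxV // mulmx1.
Qed.

(** The braid group is presented by A^2 = B^3 with A = aba, B = ab and a = B^-1 A; here [c] plays
    the role of B^-1 and [gam] rescales it. Both S A and S A^-1 are multiples of [c], which reduces
    each side of the braid relation to gam^3 A. *)
Lemma braid_of_2_3 (A c : 'M[R]_d) (gam z zi : R) : A \in unitmx ->
  A *m A = z%:M -> c *m c *m c = zi%:M -> z * zi = 1 ->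
  let S := (gam *: c) *m A in let T := invmx A *m S *m A in
  S *m T *m S = T *m S *m T.
Proof.
move=> Au AA ccc zz S T.
have SA : S *m A = (gam * z) *: c by rewrite /S -mulmxA AA mul_mx_scalar scalerA mulrC.
have SAi : S *m invmx A = gam *: c by rewrite /S mulmxK.
have -> : S *m T *m S = gam ^+ 3 *: A.
  have -> : S *m T *m S = (S *m invmx A) *m (S *m A) *m S by rewrite /T !mulmxA.
  rewrite SAi SA /S -!scalemxAl -!scalemxAr -!scalemxAl !scalerA mulmxA ccc.
  rewrite mul_scalar_mx scalerA; congr (_ *: _).
  by rewrite -[RHS]mulr1 -zz; ring.
have -> : T *m S *m T = (gam ^+ 3 * z) *: invmx A.
  have -> : T *m S *m T = invmx A *m ((S *m A) *m (S *m invmx A) *m (S *m A)).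
    by rewrite /T !mulmxA.
  rewrite SAi SA -!scalemxAl -!scalemxAr -!scalemxAl !scalerA ccc.
  rewrite -scalemxAr mul_mx_scalar !scalerA; congr (_ *: _).
  by rewrite -[RHS]mulr1 -zz; ring.
rewrite -scalerA; congr (_ *: _); apply: (can_inj (mulmxK Au)).
by rewrite AA -scalemxAl mulVmx // scale_scalar_mx mulr1.
Qed.
End MatrixPowers.

Section TraceZero.
Variables (K : fieldType) (d : nat) (b0 S0 : 'M[K]_d).
Hypotheses (b0u : b0 \in unitmx) (S0u : S0 \in unitmx).
Hypothesis cent : forall Z, Z *m b0 = b0 *m Z -> Z *m S0 = S0 *m Z -> is_scalar_mx Z.

Lemma mxtrace_mulmx_inj (Z Z' : 'M[K]_d) :
  (forall Y, \tr (Y *m Z) = \tr (Y *m Z')) -> Z = Z'.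
Proof.
move=> h; apply/matrixP => i j.
have hd (X : 'M[K]_d) : \tr (delta_mx j i *m X) = X i j.
  rewrite /mxtrace (bigD1 j) //= big1 ?addr0.
    rewrite mxE (bigD1 i) //= big1 ?addr0; first by rewrite mxE !eqxx mul1r.
    by move=> l nl; rewrite mxE (negPf nl) andbF mul0r.
  by move=> l nl; rewrite mxE big1 // => l' _; rewrite mxE (negPf nl) mul0r.
by rewrite -!hd h.
Qed.

(** Every linear functional on matrices is thus a trace Y |-> tr (Y Z). *)
Lemma mxvec_mul_tr (Y : 'M[K]_d) (v : 'cV[K]_(d * d)) :
  mxvec Y *m v = (\tr (Y *m (vec_mx v^T)^T))%:M.
Proof.
apply/matrixP=> i j; rewrite !ord1 [RHS]mxE eqxx mulr1n.
rewrite mxE /mxtrace -[v in LHS]trmxK -[v^T in LHS]vec_mxK.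
set Z := vec_mx _.
transitivity (\sum_i \sum_j Y i j * Z i j).
  rewrite pair_bigA /= (reindex _ (curry_mxvec_bij d d)) /=.
  by apply: eq_bigr => -[k l] _ /=; rewrite mxvecE mxE mxvecE.
by apply: eq_bigr => k _; rewrite mxE; apply: eq_bigr => l _; rewrite [Z^T _ _]mxE.
Qed.

Let conj1 (c : 'M[K]_d) (Y : 'M[K]_d) := Y - c *m Y *m invmx c.

Let conj1_lin c : linear (conj1 c).
Proof.
move=> a X Y; rewrite /conj1 mulmxDr mulmxDl -scalemxAr -scalemxAl.
by rewrite opprD scalerBr addrACA.
Qed.

(** By duality: a functional that kills all the matrices on the right is the trace against some Z
    commuting with [b0] and [S0]. By [cent] this Z is scalar, so the functional kills F too. *)
Lemma commutator_trace0 (F : 'M[K]_d) : \tr F = 0 ->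
  exists Y X, F = (Y - b0 *m Y *m invmx b0) + (X - S0 *m X *m invmx S0).
Proof.
move=> trF.
pose f1 : {linear 'M[K]_d -> 'M[K]_d} :=
  HB.pack (conj1 b0) (GRing.isLinear.Build _ _ _ _ _ (conj1_lin b0)).
pose f2 : {linear 'M[K]_d -> 'M[K]_d} :=
  HB.pack (conj1 S0) (GRing.isLinear.Build _ _ _ _ _ (conj1_lin S0)).
pose N := col_mx (lin_mx f1) (lin_mx f2).
suff : (mxvec F <= N)%MS.
  case/submxP => D; rewrite -[D]hsubmxK mul_row_col => e.
  exists (vec_mx (lsubmx D)), (vec_mx (rsubmx D)).
  apply: (can_inj mxvecK); rewrite e linearD.
  have le (f : {linear 'M[K]_d -> 'M[K]_d}) u : u *m lin_mx f = mxvec (f (vec_mx u)).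
    by rewrite -mul_vec_lin vec_mxK.
  by rewrite (le f1) (le f2).
rewrite submxE; apply/eqP/matrixP => i j.
have kc := mulmx_coker N.
pose v := cokermx N *m delta_mx j (0 : 'I_1).
have Nv : N *m v = 0 by rewrite /v mulmxA kc mul0mx.
pose Z := (vec_mx v^T)^T.
(* tr ((Y - c Y c^-1) Z) = 0 for all Y means Z = c^-1 Z c. *)
have orth c : c \in unitmx -> lin_mx (conj1 c) *m v = 0 -> Z *m c = c *m Z.
  move=> cu e; suff e2 : Z = invmx c *m Z *m c by rewrite {2}e2 !mulmxA mulmxV // mul1mx.
  apply: mxtrace_mulmx_inj => Y.
  apply/eqP; rewrite -subr_eq0; apply/eqP.
  transitivity (\tr (conj1 c Y *m Z)).
    rewrite /conj1 mulmxBl raddfB /=; congr (_ - _).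
    by rewrite !mulmxA mxtrace_mulC !mulmxA.
  pose f : {linear 'M[K]_d -> 'M[K]_d} :=
    HB.pack (conj1 c) (GRing.isLinear.Build _ _ _ _ _ (conj1_lin c)).
  have := mxvec_mul_tr (conj1 c Y) v; rewrite -[conj1 c Y in LHS]/(f Y).
  by rewrite -mul_vec_lin -mulmxA e mulmx0 => /matrixP/(_ 0 0); rewrite !mxE eqxx mulr1n.
have [Nv1 Nv2] : lin_mx f1 *m v = 0 /\ lin_mx f2 *m v = 0.
  by move: Nv; rewrite mul_col_mx => /eqP; rewrite col_mx_eq0 => /andP[/eqP ? /eqP ?].
have /is_scalar_mxP[c Zc] : is_scalar_mx Z by apply: cent; apply: orth.
transitivity ((mxvec F *m v) i 0); first by rewrite /v mulmxA -colE [RHS]mxE.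
by rewrite mxvec_mul_tr -/Z Zc mul_mx_scalar mxtraceZ trF mulr0 !mxE ord1 mul0rn.
Qed.
End TraceZero.

(** * Lifting order by order over a ring like K[t]/t^M, with residue map [eps] and section [iota] *)

Section Lift.
Variables (K : fieldType) (Q : comUnitRingType).
Variables (iota : {rmorphism K -> Q}) (eps : {rmorphism Q -> K}) (t : Q) (M : nat).
Hypothesis iotaK : cancel iota eps.
Hypothesis eps_ker : forall x, eps x = 0 -> exists y, x = t * y.
Hypothesis t_reg : forall m x y, (m < M)%N -> t ^+ m * x = t ^+ m.+1 * y -> eps x = 0.
Hypothesis t_nil : t ^+ M = 0.

(** Up to the unit c, x is 1 minus a multiple of t; since t is nilpotent, a finite geometric series
    inverts it. *)
Lemma eps_unit x : eps x != 0 -> x \is a GRing.unit.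
Proof.
move=> xn0; have [y xy] : exists y, x - iota (eps x) = t * y.
  by apply: eps_ker; rewrite rmorphB iotaK subrr.
pose c := iota (eps x)^-1.
have e : 1 - x * c = t * (- (y * c)).
  rewrite -[x](subrK (iota (eps x))) xy mulrDl -rmorphM mulfV // rmorph1.
  by rewrite opprD addrCA subrr addr0 mulrN mulrA.
pose s := \sum_(i < M) (1 - x * c) ^+ i.
have : (x * c) * s = 1.
  apply: oppr_inj; rewrite -mulNr -[- (x * c)](addKr 1) addrC -subrX1.
  by rewrite e exprMn t_nil mul0r sub0r.
by move=> xs; apply/unitrPr; exists (c * s); rewrite mulrA.
Qed.

Section Matrices.
Variable d : nat.
Implicit Types X Y C : 'M[Q]_d.

Lemma eps_unitmx X : map_mx eps X \in unitmx -> X \in unitmx.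
Proof.
rewrite !unitmxE det_map_mx unitfE => h; exact: eps_unit.
Qed.

Lemma eps_invmx X : X \in unitmx -> map_mx eps (invmx X) = invmx (map_mx eps X).
Proof.
move=> Xu; have Yu : map_mx eps X \in unitmx.
  by rewrite unitmxE det_map_mx rmorph_unit // -unitmxE.
by rewrite -[LHS](mulKmx Yu) -map_mxM mulmxV // map_mx1 mulmx1.
Qed.

Lemma eps_ker_mx X : map_mx eps X = 0 -> exists E, X = t *: E.
Proof.
move=> e; have [f fE] : exists f : 'I_d * 'I_d -> Q, forall ij, X ij.1 ij.2 = t * f ij.
  apply: (@fin_all_exists _ (fun=> Q) (fun ij y => X ij.1 ij.2 = t * y)) => -[i j].
  apply: eps_ker.
  by move/matrixP/(_ i j): e; rewrite !mxE.
exists (\matrix_(i, j) f (i, j)); apply/matrixP=> i j.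
by rewrite !mxE (fE (i, j)).
Qed.

Lemma conj_expand m Y C : 1%:M + t ^+ m.+1 *: Y \in unitmx ->
  exists Z, (1%:M + t ^+ m.+1 *: Y) *m C *m invmx (1%:M + t ^+ m.+1 *: Y) =
    C + t ^+ m.+1 *: (Y *m C - C *m Y) + t ^+ m.+2 *: Z.
Proof.
set P := 1%:M + _ => Pu.
exists (- t ^+ m *: ((Y *m C - C *m Y) *m Y *m invmx P)).
have PC : P *m C = C *m P + t ^+ m.+1 *: (Y *m C - C *m Y).
  rewrite /P mulmxDl mulmxDr mul1mx mulmx1 -scalemxAl -scalemxAr scalerBr.
  by rewrite -addrA; congr (_ + _); rewrite addrC subrK.
rewrite PC mulmxDl mulmxK // -addrA -scalemxAl; congr (_ + _).
have iP : invmx P = 1%:M - t ^+ m.+1 *: (Y *m invmx P).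
  by apply/eqP; rewrite eq_sym subr_eq -[X in _ == X + _]mul1mx scalemxAl -mulmxDl mulmxV.
rewrite {1}iP mulmxBr mulmx1 -scalemxAr scalerBr; congr (_ + _).
by rewrite !scalerA !mulmxA mulrN scaleNr -!exprD addSnnS addnC.
Qed.

Variables (A0 b0 S0 : 'M[K]_d) (gam : Q) (Du : 'M[Q]_d).
Hypotheses (A0u : A0 \in unitmx) (b0u : b0 \in unitmx) (S0E : S0 = b0 *m A0).
Hypothesis cent : forall Z, Z *m b0 = b0 *m Z -> Z *m S0 = S0 *m Z -> is_scalar_mx Z.
Hypotheses (gam1 : eps gam = 1) (Du0 : map_mx eps Du = S0).
Hypothesis detDu : gam ^+ d * iota (\det S0) = \det Du.

Let S0u : S0 \in unitmx. Proof. by rewrite S0E unitmx_mul b0u. Qed.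
Let A := map_mx iota A0.
Let b := map_mx iota b0.

Lemma eps_iota_mx (X : 'M[K]_d) : map_mx eps (map_mx iota X) = X.
Proof. by apply/matrixP=> i j; rewrite !mxE iotaK. Qed.

(** Induction on the order m of agreement. Multiplying [h] and [g] on the left by matrices 1 +
    t^(m+1) W changes the leading error by commutators with [b0] and [S0]. These fill the matrices
    of trace zero, and equality of determinants puts the error there. *)
Lemma lift_approx m : (m < M)%N -> exists g h E,
  [/\ map_mx eps g = 1%:M, map_mx eps h = 1%:M &
      (gam *: (h *m b *m invmx h)) *m A = g *m Du *m invmx g + t ^+ m.+1 *: E].
Proof.
elim: m => [|m IH] mM.
  have [E hE] : exists E, (gam *: b) *m A - Du = t *: E.
    apply: eps_ker_mx; rewrite map_mxB map_mxM map_mxZ gam1 scale1r !eps_iota_mx.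
    by rewrite Du0 S0E subrr.
  exists 1%:M, 1%:M, E; rewrite !map_mx1; split=> //.
  by rewrite invmx1 !mul1mx !mulmx1 expr1 -hE addrC subrK.
have [g [h [E [g1 h1 LR]]]] := IH (ltnW mM).
have unit1 X : map_mx eps X = 1%:M -> X \in unitmx.
  by move=> e; apply: eps_unitmx; rewrite e unitmx1.
have [gu hu] := (unit1 _ g1, unit1 _ h1).
set L := gam *: _ in LR; set R := g *m Du *m _ in LR.
have L0 : map_mx eps L = b0.
  by rewrite map_mxZ gam1 scale1r !map_mxM eps_invmx // h1 invmx1 eps_iota_mx mul1mx mulmx1.
have R0 : map_mx eps R = S0.
  by rewrite !map_mxM eps_invmx // g1 invmx1 Du0 mul1mx mulmx1.
have Ru : R \in unitmx by apply: eps_unitmx; rewrite R0.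
(* Equal determinants give det (1 + t^(m+1) R^-1 E) = 1. The term of order m+1 in this expansion is
   the trace, so the trace vanishes modulo t. *)
have trE : \tr (map_mx eps E *m invmx S0) = 0.
  have detLR : \det (L *m A) = \det R.
    rewrite /L /R -scalemxAl detZ !det_mulmx !det_inv -detDu S0E det_mulmx rmorphM.
    rewrite !det_map_mx; move: gu hu; rewrite !unitmxE.
    move: (\det h) (\det g) => x y yu xu.
    by rewrite [x * _]mulrC mulrK // [y * _]mulrC mulrK.
  have [q hq] := det_addmx_scale (t ^+ m.+1) (invmx R *m E).
  have det1 : \det (1%:M + t ^+ m.+1 *: (invmx R *m E)) = 1.
    apply: (mulrI (x := \det R)); first by rewrite -unitmxE.
    rewrite -det_mulmx mulmxDr mulmx1 -scalemxAr mulmxA mulmxV // mul1mx -LR.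
    by rewrite detLR mulr1.
  have : eps (\tr (invmx R *m E)) = 0.
    apply: (t_reg (m := m.+1) (y := - (t ^+ m * q))) => //.
    have e : t ^+ m.+1 * \tr (invmx R *m E) = - ((t ^+ m.+1) ^+ 2 * q).
      apply/eqP; rewrite -addr_eq0; apply/eqP; apply: (addrI 1).
      by rewrite addr0 addrA -hq det1.
    rewrite e mulrN mulrA -exprD -exprM muln2 -addnn.
    by rewrite !addSn !addnS.
  by rewrite -trace_map_mx map_mxM eps_invmx // R0 mxtrace_mulC.
have LP P : P \in unitmx ->
    gam *: (P *m h *m b *m invmx (P *m h)) = P *m L *m invmx P.
  by move=> Pu; rewrite invmx_mul // /L !mulmxA -!scalemxAr -!scalemxAl !mulmxA.
have RP P : P \in unitmx -> P *m g *m Du *m invmx (P *m g) = P *m R *m invmx P.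
  by move=> Pu; rewrite invmx_mul // /R !mulmxA.
clearbody L R.
have [Y [X hYX]] := commutator_trace0 b0u S0u cent
  (F := - (map_mx eps E *m invmx S0)) (ltac:(by rewrite raddfN /= trE oppr0)).
(* The sign of [X] changes because it corrects the right-hand side of the equation. *)
pose Y' := map_mx iota Y; pose X' := map_mx iota (- X).
have eps1 W : map_mx eps (1%:M + t ^+ m.+1 *: W) = 1%:M.
  rewrite map_mxD map_mx1 map_mxZ rmorphXn.
  have -> : eps t = 0 by apply: (t_reg (m := 0) (y := 1)); rewrite ?mulr1 ?mul1r ?(leq_trans _ mM).
  by rewrite expr0n scale0r addr0.
pose P := 1%:M + t ^+ m.+1 *: Y'; pose P' := 1%:M + t ^+ m.+1 *: X'.
have [Pu P'u] : P \in unitmx /\ P' \in unitmx by split; apply: unit1; apply: eps1.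
have [Z1 hZ1] := conj_expand L Pu; have [Z2 hZ2] := conj_expand R P'u.
exists (P' *m g), (P *m h).
rewrite LP // RP //.
rewrite -/P in hZ1; rewrite -/P' in hZ2; rewrite hZ1 hZ2.
(* [C] is the coefficient of t^(m+1) in the new error; Y and X were chosen to make it vanish modulo
   t. *)
pose C := E + (Y' *m L - L *m Y') *m A - (X' *m R - R *m X').
have [E' hE'] : exists E', C = t *: E'.
  apply: eps_ker_mx; rewrite /C map_mxB map_mxD map_mxM !map_mxB !map_mxM !eps_iota_mx L0 R0.
  have eE : map_mx eps E = - ((Y *m b0 - b0 *m Y) *m A0 + (X *m S0 - S0 *m X)).
    rewrite -[LHS](mulmxKV S0u) -[_ *m invmx S0]opprK hYX mulNmx; congr (- _).
    rewrite [LHS]mulmxDl; congr (_ + _); rewrite [LHS]mulmxBl ?mulmxKV //.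
    by rewrite mulmxBl {2}S0E !mulmxA mulmxKV // S0E mulmxA.
  rewrite eE; set u := (_ *m A0); set v := X *m S0 - _.
  have -> : - X *m S0 - S0 *m (- X) = - v by rewrite mulNmx mulmxN opprB opprK addrC.
  by rewrite opprK opprD -addrA addrACA !addNr addr0.
exists (E' + Z1 *m A - Z2); rewrite !map_mxM g1 h1 !eps1 !mulmx1; split=> //.
move: hE'; rewrite /C; move: (Y' *m L - L *m Y') (X' *m R - R *m X') => U V hE'.
rewrite !mulmxDl LR -!scalemxAl -[E' + _ - _]addrA scalerDr [t ^+ m.+2]exprSr.
rewrite -[_ *: E']scalerA -hE' -exprSr !scalerDr !scalerN !addrA.
apply/eqP; rewrite eq_sym subr_eq; apply/eqP.
by rewrite [LHS](ACl ((2*6)*1*4*5*7*3))%AC /= subrr add0r.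
Qed.

Lemma lift_exists : (0 < M)%N -> exists g h,
  [/\ map_mx eps g = 1%:M, map_mx eps h = 1%:M &
      (gam *: (h *m b *m invmx h)) *m A = g *m Du *m invmx g].
Proof.
move=> M0; have [] := @lift_approx M.-1; first by rewrite prednK.
move=> g [h [E [g1 h1]]]; rewrite prednK // t_nil scale0r addr0 => LR.
by exists g, h.
Qed.

Variables (k : nat) (c : 'I_k -> Q) (P : 'M[K]_d) (du : 'rV[Q]_d) (z0 : K).
Hypotheses (Pu : P \in unitmx) (z0n0 : z0 != 0).
Hypothesis DuE : Du = map_mx iota P *m diag_mx du *m invmx (map_mx iota P).
Hypothesis du_root : forall i, du 0 i ^+ k = \sum_(j < k) c j * du 0 i ^+ j.
Hypotheses (A0A0 : A0 *m A0 = z0%:M) (b03 : b0 *m b0 *m b0 = (z0^-1)%:M).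

(** S is conjugate to a diagonal matrix with the prescribed eigenvalues, and T is conjugate to S by
    A, which gives both Hecke relations. The braid relation holds because A stays fixed and [b] is
    only conjugated and rescaled, as in [braid_of_2_3]. *)
Lemma lift_braid_hecke : (0 < M)%N -> exists S T : 'M[Q]_d,
  [/\ S \in unitmx /\ T \in unitmx, S *m T *m S = T *m S *m T,
      S ^+ k = \sum_(j < k) c j *: S ^+ j,
      T ^+ k = \sum_(j < k) c j *: T ^+ j &
      map_mx eps S = S0 /\ map_mx eps T = invmx A0 *m S0 *m A0].
Proof.
move=> M0; have [g [h [g1 h1 LR]]] := lift_exists M0.
have unit1 X : map_mx eps X = 1%:M -> X \in unitmx.
  by move=> e; apply: eps_unitmx; rewrite e unitmx1.
have [gu hu] := (unit1 _ g1, unit1 _ h1).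
pose cc := h *m b *m invmx h; pose Pq := map_mx iota P.
pose S := (gam *: cc) *m A; pose T := invmx A *m S *m A.
have Au : A \in unitmx by apply: eps_unitmx; rewrite eps_iota_mx.
have Pqu : Pq \in unitmx by apply: eps_unitmx; rewrite eps_iota_mx.
have gPu : g *m Pq \in unitmx by rewrite unitmx_mul gu Pqu.
have SE : S = (g *m Pq) *m diag_mx du *m invmx (g *m Pq).
  by rewrite /S LR DuE conjmx_conj.
have Sk : S ^+ k = \sum_(j < k) c j *: S ^+ j by rewrite SE; apply: diag_conj_root.
have S0' : map_mx eps S = S0.
  rewrite /S map_mxM map_mxZ gam1 scale1r /cc !map_mxM eps_invmx // h1 invmx1.
  by rewrite !eps_iota_mx mul1mx mulmx1.
have Su : S \in unitmx by apply: eps_unitmx; rewrite S0'.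
have TE : T = invmx A *m S *m invmx (invmx A) by rewrite invmxK.
exists S, T; split=> //.
- by split=> //; rewrite /T unitmx_mul [X in X && _]unitmx_mul unitmx_inv Au Su.
- apply: (@braid_of_2_3 _ _ A cc gam (iota z0) (iota z0^-1)) => //.
  + by rewrite /A -map_mxM A0A0 map_scalar_mx.
  + by apply: conjmx_cube => //; rewrite -!map_mxM b03 map_scalar_mx.
  + by rewrite -rmorphM mulfV ?rmorph1.
- rewrite TE conjmx_exp ?unitmx_inv // Sk mulmx_sumr mulmx_suml; apply: eq_bigr => j _.
  by rewrite conjmx_exp ?unitmx_inv // -scalemxAr -scalemxAl.
- by split=> //; rewrite /T map_mxM [X in X *m _]map_mxM eps_invmx // S0' eps_iota_mx.
Qed.
End Matrices.
End Lift.

(** * The truncated polynomial ring K[X]/X^(n+1) *)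

Section TruncatedPoly.
Variables (K : fieldType) (n : nat).
Definition tpoly := {poly %/ ('X^(n.+1) : {poly K})}.
HB.instance Definition _ := GRing.ComUnitRing.on tpoly.
Notation Q := tpoly.

Definition qin : {poly K} -> Q := in_qpoly ('X^(n.+1) : {poly K}).
HB.instance Definition _ :=
  GRing.RMorphism.copy qin (in_qpoly ('X^(n.+1) : {poly K})).

Lemma coef_qin (p : {poly K}) i : (i < n.+1)%N ->
  (qin p : {poly K})`_i = p`_i.
Proof.
move=> lti; rewrite /qin /in_qpoly /= mk_monic_Xn.
rewrite [in RHS](Pdiv.RingMonic.rdivp_eq (monicXn K n.+1) p).
by rewrite coefD coefMXn lti add0r.
Qed.

Lemma qin_val (x : Q) : qin x = x.
Proof.
by apply: val_inj; apply: in_qpoly_small; apply: size_mk_monic.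
Qed.

Lemma size_qpolyXn (x : Q) : (size (x : {poly K}) <= n.+1)%N.
Proof.
by rewrite -ltnS; apply: (leq_trans (size_mk_monic x)); rewrite mk_monic_Xn size_polyXn.
Qed.

Definition qeps (x : Q) : K := (x : {poly K})`_0.

Lemma qeps_in p : qeps (qin p) = p`_0.
Proof. exact: coef_qin. Qed.

Fact qeps_zmod : zmod_morphism qeps.
Proof. by move=> x y; rewrite -(qin_val x) -(qin_val y) -rmorphB !qeps_in coefB. Qed.
Fact qeps_mon : monoid_morphism qeps.
Proof.
split; first by rewrite -(rmorph1 qin) qeps_in coef1.
by move=> x y; rewrite -(qin_val x) -(qin_val y) -rmorphM !qeps_in coef0M.
Qed.
HB.instance Definition _ := GRing.isZmodMorphism.Build Q K qeps qeps_zmod.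
HB.instance Definition _ := GRing.isMonoidMorphism.Build Q K qeps qeps_mon.

Definition qt : Q := qin 'X.
Definition qiota : K -> Q := qpolyC ('X^(n.+1)).
HB.instance Definition _ := GRing.RMorphism.on qiota.

Lemma qiotaE c : qiota c = qin c%:P.
Proof. by rewrite -[LHS]qin_val qpolyCE. Qed.

Lemma qiotaK : cancel qiota qeps.
Proof. by move=> c; rewrite qiotaE qeps_in coefC. Qed.

Lemma qeps_ker x : qeps x = 0 -> exists y, x = qt * y.
Proof.
move=> x0; exists (qin (\poly_(i < (size (x : {poly K}))) (x : {poly K})`_i.+1)).
rewrite -[LHS]qin_val -rmorphM; congr qin.
apply/polyP=> i; rewrite coefXM coef_poly; case: i => [|i] //=.
by case: ltnP => // h; rewrite nth_default // ltnW.
Qed.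

Lemma qt_reg m x y : (m < n.+1)%N -> qt ^+ m * x = qt ^+ m.+1 * y -> qeps x = 0.
Proof.
move=> lm; rewrite -(qin_val x) -(qin_val y) -!rmorphXn -!rmorphM.
move=> /(congr1 (fun q : Q => (q : {poly K})`_m)).
by rewrite /= !coef_qin // !coefXnM ltnSn ltnn subnn qeps_in.
Qed.

Lemma qt_nil : qt ^+ n.+1 = 0.
Proof.
rewrite -rmorphXn; apply: val_inj; apply/polyP => i /=.
by rewrite mk_monic_Xn Pdiv.RingMonic.rmodpp ?monicXn.
Qed.

Lemma qin_lead (p : {poly K}) : (forall i, (i < n)%N -> p`_i = 0) ->
  qin p = qt ^+ n * qiota p`_n.
Proof.
move=> p0; rewrite qiotaE -rmorphXn -rmorphM; apply: val_inj; apply/polyP => i.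
have [li|gi] := ltnP i n.+1; last first.
  have h (q : Q) : (q : {poly K})`_i = 0.
    by rewrite nth_default //; apply: (leq_trans (size_qpolyXn q) gi).
  exact: etrans (h _) (esym (h _)).
rewrite !coef_qin // coefXnM; case: ltnP => [/p0 //|h].
by have -> : i = n by [apply/eqP; rewrite eqn_leq h -ltnS li]; rewrite subnn coefC.
Qed.

End TruncatedPoly.

(** * Hecke parameters with prescribed roots *)

Section Roots.
Variables (k : nat) (u : 'I_k -> {poly algC}).
Definition root_poly : {poly {poly algC}} := \prod_(j < k) ('X - (u j)%:P).
(** The sign makes [root_poly] equal to X^k - \sum_j a_j X^j with a_j = [hecke_coef j]. *)
Definition hecke_coef (j : 'I_k) : {poly algC} := - root_poly`_j.

Lemma hecke_coef_root j : u j ^+ k = \sum_(i < k) hecke_coef i * u j ^+ i.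
Proof.
have sz : size root_poly = k.+1.
  by rewrite /root_poly size_prod_XsubC /index_enum -enumT size_enum_ord.
have r : root_poly.[u j] = 0.
  by rewrite /root_poly horner_prod (bigD1 j) //= hornerXsubC subrr mul0r.
have m : root_poly`_k = 1.
  have /eqP <- : root_poly \is monic by rewrite monic_prod_XsubC.
  by rewrite lead_coefE sz.
move: r; rewrite horner_coef sz big_ord_recr /= m mul1r => /eqP.
rewrite addrC addr_eq0 => /eqP ->; rewrite -sumrN; apply: eq_bigr => i _.
by rewrite mulNr.
Qed.
End Roots.

Section TruncatedMatrices.
Variables (K : fieldType) (n d : nat).
Notation iota := (@qiota K n).
Notation eps := (@qeps K n).

Lemma qiota_mxK (X : 'M[K]_d) : map_mx eps (map_mx iota X) = X.
Proof. exact: (eps_iota_mx (@qiotaK K n)). Qed.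

Lemma qeps_unitmx (X : 'M[tpoly K n]_d) : map_mx eps X \in unitmx -> X \in unitmx.
Proof. exact: (eps_unitmx (@qiotaK K n) (@qeps_ker K n) (@qt_nil K n)). Qed.

Lemma qeps_invmx (X : 'M[tpoly K n]_d) : X \in unitmx ->
  map_mx eps (invmx X) = invmx (map_mx eps X).
Proof. exact: eps_invmx. Qed.
End TruncatedMatrices.

(** * Deformation of an irreducible representation along a curve of parameters *)

Section Deform.
Variables (gT : finGroupType) (s1 s2 : gT) (k : nat).
Hypotheses (braid : (s1 * s2 * s1 = s2 * s1 * s2)%g) (s1k : (s1 ^+ k = 1)%g).
Let G : {group gT} := <<[set s1; s2]>>%G.
Variables (zeta : algC) (x : 'I_k -> algC) (N0 n : nat).
Hypothesis zetaP : k.-primitive_root zeta.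
Notation Q := (tpoly algC n).
Notation inq := (@qin algC n).
Notation iota := (@qiota algC n).
Notation eps := (@qeps algC n).

(** At X = 0 the roots are the k-th roots of unity. The exponent [N0] will be a multiple of the
    degree d, so that a ratio of determinants has a polynomial d-th root. *)
Definition root_path (j : 'I_k) : {poly algC} := zeta ^+ j *: (1 + x j *: 'X) ^+ N0.
Let al := hecke_coef root_path.

Lemma root_path0 j : (root_path j)`_0 = zeta ^+ j.
Proof.
rewrite /root_path coefZ -horner_coef0 horner_exp !hornerE.
by rewrite ?mulr0 ?addr0 expr1n mulr1.
Qed.

Lemma gen_s1 : s1 \in G. Proof. by rewrite mem_gen // !inE eqxx. Qed.
Lemma gen_s2 : s2 \in G. Proof. by rewrite mem_gen // !inE eqxx orbT. Qed.

(** The images of aba and (ab)^-1 serve as [A0] and [b0]. By Schur's lemma the central element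
    (aba)^2 acts by a scalar. The image of a is diagonalisable with k-th roots of unity as
    eigenvalues, and each eigenvalue zeta^j is moved along [root_path j]. *)
Lemma deform_irr d (rG : mx_representation algC G d) :
  mx_irreducible rG -> (d %| N0)%N -> exists S T : 'M[Q]_d,
  [/\ S \in unitmx /\ T \in unitmx, S *m T *m S = T *m S *m T,
      S ^+ k = \sum_(j < k) inq (al j) *: S ^+ j,
      T ^+ k = \sum_(j < k) inq (al j) *: T ^+ j &
      map_mx eps S = rG s1 /\ map_mx eps T = rG s2].
Proof.
move=> irr /dvdnP[N1 N0E].
have [G1 G2] := (gen_s1, gen_s2).
have absirr : mx_absolutely_irreducible rG.
  exact: (groupC (G := G)).
have d_gt0 : (0 < d)%N by case/mx_irrP: irr.
have cent_gen (Z : 'M_d) : Z *m rG s1 = rG s1 *m Z -> Z *m rG s2 = rG s2 *m Z ->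
    is_scalar_mx Z.
  move=> c1 c2; apply: (mx_abs_irr_cent_scalar absirr).
  rewrite /centgmx gen_subG; apply/subsetP => y; rewrite !inE.
  by case/orP=> /eqP->; rewrite ?G1 ?G2 ?c1 ?c2 eqxx.
have [D DE] : exists D, D = (s1 * s2 * s1)%g by eexists.
have [B BE] : exists B, B = (s1 * s2)%g by eexists.
have GD : D \in G by rewrite DE !groupM.
have GB : B \in G by rewrite BE groupM.
have Ds1 : (s1 * D = D * s2)%g by rewrite DE {1}braid !mulgA.
have Ds2 : (s2 * D = D * s1)%g by rewrite DE !mulgA -braid.
pose A0 := rG D; pose b0 := rG B^-1%g; pose S0 := rG s1.
have S0E : S0 = b0 *m A0.
  by rewrite /b0 /A0 -repr_mxM ?groupV // DE -BE mulKg.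
have A0u : A0 \in unitmx by apply: repr_mx_unit.
have b0u : b0 \in unitmx by apply: repr_mx_unit; rewrite groupV.
have cent Z : Z *m b0 = b0 *m Z -> Z *m S0 = S0 *m Z -> is_scalar_mx Z.
  move=> cb cs; apply: cent_gen => //.
  have s2E : s2 = (s1^-1 * B)%g by rewrite BE mulKg.
  rewrite s2E repr_mxM ?groupV // repr_mxV // -[B]invgK repr_mxV ?groupV //.
  rewrite -/S0 -/b0.
  have comm (X : 'M_d) : X \in unitmx -> Z *m X = X *m Z -> Z *m invmx X = invmx X *m Z.
    move=> Xu e; apply: (can_inj (mulKmx Xu)); rewrite mulmxA -e mulmxK //.
    by rewrite mulmxA mulmxV // mul1mx.
  have S0u : S0 \in unitmx by apply: repr_mx_unit.
  by rewrite mulmxA (comm _ S0u cs) -[LHS]mulmxA (comm _ b0u cb) mulmxA.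
have [z0 A0A0] : exists z0, A0 *m A0 = z0%:M.
  apply/is_scalar_mxP; apply: cent_gen.
    by rewrite -!repr_mxM ?groupM // !mulgA Ds1 -!mulgA Ds2.
  by rewrite -!repr_mxM ?groupM // !mulgA Ds2 -!mulgA Ds1.
have BBB : (B * B * B = D * D)%g.
  by rewrite BE DE -!mulgA; do 3!congr (_ * _)%g; rewrite !mulgA -braid.
have z0n0 : z0 != 0.
  apply: contraTneq A0u => z00; rewrite -[A0 \in _]andbb -unitmx_mul A0A0 z00.
  by rewrite unitmxE det_scalar expr0n (gtn_eqF d_gt0) unitr0.
have b03 : b0 *m b0 *m b0 = (z0^-1)%:M.
  rewrite -!repr_mxM ?groupM ?groupV // -!invMg mulgA BBB repr_mxV ?groupM // repr_mxM //.
  by rewrite -/A0 A0A0 invmx_scalar.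
have [e [[P Pu S0P] [eo _] _ _]] := repr_rsim_diag rG G1.
have ek i : e 0 i ^+ k = 1.
  have /dvdnP[q ->] : (#[s1]%g %| k)%N by rewrite order_dvdn s1k.
  by rewrite mulnC exprM eo expr1n.
have [sig sigE] : exists sig : 'I_d -> 'I_k, forall i, e 0 i = zeta ^+ sig i.
  apply: (@fin_all_exists _ (fun=> 'I_k) (fun i j => e 0 i = zeta ^+ j)) => i.
  by have [j jE] := prim_rootP zetaP (ek i); exists j.
(* The condition on [gam] is gam^d = det Du / det S0. This ratio is a product of N0-th powers with
   N0 = N1 * d. *)
pose gam : Q := inq (\prod_i (1 + x (sig i) *: 'X) ^+ N1).
pose du := \row_i inq (root_path (sig i)).
pose Pq := map_mx iota (invmx P).
have Pqu : Pq \in unitmx.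
  by apply: qeps_unitmx; rewrite qiota_mxK unitmx_inv.
pose Du := Pq *m diag_mx du *m invmx Pq.
have gam1 : eps gam = 1.
  rewrite qeps_in -horner_coef0 horner_prod big1 // => i _.
  by rewrite horner_exp !hornerE ?mulr0 ?addr0 expr1n.
have Du0 : map_mx eps Du = S0.
  rewrite !map_mxM qeps_invmx // qiota_mxK.
  rewrite invmxK /S0 S0P; congr (_ *m _ *m _).
  apply/matrixP=> i j; rewrite !mxE; case: eqP => _; rewrite ?mulr0n ?rmorph0 //.
  by rewrite !mulr1n /= qeps_in root_path0 sigE.
have detDu : gam ^+ d * iota (\det S0) = \det Du.
  rewrite /Du !det_mulmx det_inv [RHS]mulrAC mulrV -?unitmxE // mul1r det_diag.
  rewrite /S0 S0P !det_mulmx det_inv mulrAC mulVr -?unitmxE // mul1r det_diag.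
  under eq_bigr do rewrite sigE.
  under [RHS]eq_bigr do rewrite mxE.
  rewrite -rmorph_prod qiotaE -rmorphXn -rmorphM; congr inq.
  rewrite prodrXl -exprM -N0E -prodrXl rmorph_prod -big_split /=.
  by apply: eq_bigr => i _; rewrite /root_path -[RHS]mul_polyC mulrC.
have du_root i : du 0 i ^+ k = \sum_(j < k) inq (al j) * du 0 i ^+ j.
  rewrite mxE -rmorphXn hecke_coef_root rmorph_sum.
  by apply: eq_bigr => j _; rewrite rmorphM rmorphXn.
have iPu : invmx P \in unitmx by rewrite unitmx_inv.
have [S [T [STu STS Sk Tk [S0' T0']]]] :=
  lift_braid_hecke (@qiotaK algC n) (@qeps_ker algC n) (@qt_reg algC n)
    (@qt_nil algC n) A0u b0u S0E cent gam1 Du0 detDu iPu z0n0 (erefl Du) du_root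
    A0A0 b03 (ltn0Sn n).
exists S, T; split; [exact: STu | exact: STS | exact: Sk | exact: Tk | split; first exact: S0'].
rewrite T0'.
by rewrite /A0 /S0 -repr_mxV // -!repr_mxM ?groupM ?groupV // -mulgA Ds1 mulKg.
Qed.
End Deform.

(** * Linear independence *)

Section NonvanishingPoint.

Lemma digits_inj n D (f g : 'I_n -> nat) :
  (forall i, f i < D)%N -> (forall i, g i < D)%N ->
  (\sum_(i < n) f i * D ^ i = \sum_(i < n) g i * D ^ i)%N -> f =1 g.
Proof.
elim: n f g => [|n IH] f g hf hg; first by move=> _ [].
rewrite !big_ord_recl /= !expn0 !muln1.
have shift (h : 'I_n.+1 -> nat) : (\sum_(i < n) h (lift ord0 i) * D ^ bump 0 i)%N =
    (D * \sum_(i < n) h (lift ord0 i) * D ^ i)%N.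
  by rewrite big_distrr; apply: eq_bigr => i _; rewrite /bump /= add1n expnS mulnCA.
rewrite !shift => e.
have D0 : (0 < D)%N by apply: leq_ltn_trans (hf ord0).
have e0 : f ord0 = g ord0.
  have := congr1 (modn^~ D) e.
  by rewrite ![(_ + D * _)%N]addnC ![(D * _)%N]mulnC !modnMDl !modn_small.
move: e; rewrite e0 => /addnI/eqP; rewrite eqn_pmul2l // => /eqP e i.
have [j ->|->//] := unliftP ord0 i.
by apply: (IH (fun j => f (lift ord0 j)) (fun j => g (lift ord0 j))).
Qed.

(* Kronecker substitution: [X_i := T ^ (D ^ i)] separates the monomials of degree < D *)
Lemma mpoly_nonroot n (p : {mpoly int[n]}) : p != 0 ->
  exists a : 'I_n -> algC, mmap intr a p != 0.
Proof.
move=> pn0; pose D := msize p.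
pose code (m : 'X_{1..n}) := (\sum_(i < n) m i * D ^ i)%N.
pose q : {poly algC} := \sum_(m <- msupp p) (p@_m)%:~R *: 'X^(code m).
have lt_msupp m : m \in msupp p -> forall i, (m i < D)%N.
  move=> /msize_mdeg_lt hm i; apply: leq_ltn_trans hm.
  by rewrite mdegE (bigD1 i) //= leq_addr.
have qn0 : q != 0.
  have [m0 m0p] : exists m, m \in msupp p.
    have : msupp p != [::] by rewrite msupp_eq0.
    by case: (msupp p) => // m s _; exists m; rewrite mem_head.
  apply/eqP => /(congr1 (fun r : {poly algC} => r`_(code m0))).
  rewrite /q coef_sum coef0 (bigD1_seq m0) ?msupp_uniq //= big_seq_cond big1.
    rewrite addr0 coefZ coefXn eqxx mulr1 => /eqP; rewrite intr_eq0.
    by apply/negP; rewrite mcoeff_eq0 m0p.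
  move=> m /andP[mp mm0]; rewrite coefZ coefXn.
  case: eqP => [e|_]; last by rewrite mulr0.
  case/eqP: mm0; apply/mnmP => i; apply/esym.
  by apply: (digits_inj (lt_msupp _ m0p) (lt_msupp _ mp)).
have [x qx] : exists x, q.[x] != 0 by apply/closed_nonrootP.
exists (fun i => x ^+ (D ^ i)).
suff -> : mmap intr (fun i : 'I_n => x ^+ (D ^ i)) p = q.[x] by [].
rewrite /q horner_sum /mmap; apply: eq_bigr => m _.
rewrite hornerZ hornerXn; congr (_ * _).
rewrite /mmap1 -prodrXr; apply: eq_bigr => i _.
by rewrite -exprM mulnC.
Qed.

End NonvanishingPoint.

Section Path.
Variables (k : nat) (zeta : algC) (N0 : nat).
Hypotheses (zn0 : zeta != 0) (N0_gt0 : (0 < N0)%N).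
Notation ph x := (mmap (intr : int -> {poly algC}) (hecke_coef (root_path zeta x N0))).

(** Take a point a with p(a) != 0 and factor X^k - \sum_j a_j X^j over algC. Taking N0-th roots,
    choose x so that the curve passes through these roots at parameter 1; there p takes the value
    p(a). *)
Lemma path_exists (p : {mpoly int[k]}) : p != 0 ->
  exists x : 'I_k -> algC, ph x p != 0.
Proof.
move=> /mpoly_nonroot[a pa].
pose g : {poly algC} := \poly_(j < k) (if insub j is Some i then a i else 0).
pose f := 'X^k - g.
have szl : (size (- g) < k.+1)%N.
  by rewrite size_polyN ltnS size_poly.
have szf : size f = k.+1 by rewrite size_polyDl size_polyXn.
have mf : lead_coef f = 1 by rewrite lead_coefDl ?size_polyXn // lead_coefXn.
have [r fr] := closed_field_poly_normal f.
move: fr; rewrite mf scale1r => fr.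
have szr : size r = k by apply: succn_inj; rewrite -szf fr size_prod_XsubC.
pose x (j : 'I_k) := N0.-root (r`_j / zeta ^+ j) - 1.
exists x.
have path1 j : (root_path zeta x N0 j).[1] = r`_j.
  rewrite /root_path hornerZ horner_exp hornerD hornerZ hornerX -polyC1 hornerC mulr1.
  rewrite /x [1 + _]addrC subrK rootCK //.
  by rewrite mulrC divfK // expf_neq0.
have feq : map_poly (horner_eval 1) (root_poly (root_path zeta x N0)) = f.
  rewrite fr rmorph_prod /= [RHS](big_nth 0) szr big_mkord; apply: eq_bigr => i _.
  by rewrite rmorphB /= map_polyX map_polyC /= /horner_eval path1.
have coef1 j : (hecke_coef (root_path zeta x N0) j).[1] = a j.
  rewrite /hecke_coef hornerN -[_.[1]]/(horner_eval 1 _) -coef_map /= feq.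
  by rewrite /f coefB coefXn (ltn_eqF (ltn_ord j)) sub0r opprK /g coef_poly ltn_ord valK.
apply: contra pa => /eqP/(congr1 (horner_eval 1)); rewrite rmorph0 => <-.
rewrite /mmap rmorph_sum; apply/eqP/eq_bigr => m _.
rewrite rmorphM rmorph_int; congr (_ * _).
rewrite /mmap1 rmorph_prod; apply: eq_bigr => i _.
by rewrite rmorphXn /= /horner_eval coef1.
Qed.
End Path.

Definition letter_val (T : Type) (a b ai bi : T) (l : 'I_4) : T := nth a [:: a; b; ai; bi] l.

Lemma letter_val1 T a b ai bi : @letter_val T a b ai bi l1 = a.
Proof. by rewrite /letter_val /l1 inordK. Qed.
Lemma letter_val2 T a b ai bi : @letter_val T a b ai bi l2 = b.
Proof. by rewrite /letter_val /l2 inordK. Qed.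
Lemma letter_val1i T a b ai bi : @letter_val T a b ai bi l1i = ai.
Proof. by rewrite /letter_val /l1i inordK. Qed.
Lemma letter_val2i T a b ai bi : @letter_val T a b ai bi l2i = bi.
Proof. by rewrite /letter_val /l2i inordK. Qed.
Definition letter_valE := (letter_val1, letter_val2, letter_val1i, letter_val2i).

(** * Evaluation of formal sums at matrices *)

Section LinearExtension.
Variables (R : comNzRingType) (S : R -> Prop) (Q : comNzRingType) (psi : R -> Q).
Hypotheses (S0 : S 0) (SD : forall x y, S x -> S y -> S (x + y)).
Hypothesis psiD : forall x y, S x -> S y -> psi (x + y) = psi x + psi y.
Variables (V : lmodType Q) (F : word -> V).

(** [psi] is additive on the subring [S] only: a specialisation of R_k need not extend to the whole
    fraction field. *)
Definition lin_fsum (p : fsum R) : V := \sum_(t <- p) psi t.1 *: F t.2.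

Lemma psi_0 : psi 0 = 0.
Proof. by apply: (addrI (psi 0)); rewrite -psiD // !addr0. Qed.

Lemma psi_sum (I : eqType) (r : seq I) (P : pred I) (G : I -> R) :
  (forall i, i \in r -> S (G i)) ->
  S (\sum_(i <- r | P i) G i) /\
  psi (\sum_(i <- r | P i) G i) = \sum_(i <- r | P i) psi (G i).
Proof.
elim: r => [|i r IH] h; first by rewrite !big_nil psi_0.
have [|Sr IHr] := IH; first by move=> j jr; apply: h; rewrite inE jr orbT.
have Si : S (G i) by apply: h; rewrite mem_head.
rewrite !big_cons; case: (P i) => //.
by split; [apply: SD | rewrite psiD ?IHr].
Qed.

Lemma lin_fsum_coef (p : fsum R) (s : seq word) : coefs_in S p -> uniq s ->
  {subset [seq t.2 | t <- p] <= s} ->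
  lin_fsum p = \sum_(w <- s) psi (coef p w) *: F w.
Proof.
move=> Sp us sub.
have -> : \sum_(w <- s) psi (coef p w) *: F w =
   \sum_(w <- s) \sum_(t <- p | t.2 == w) psi t.1 *: F w.
  apply: eq_bigr => w _; rewrite /coef -scaler_suml; congr (_ *: _).
  by have [] := @psi_sum _ p (fun t => t.2 == w) (fun t => t.1) Sp.
rewrite (exchange_big_dep predT) //= /lin_fsum big_seq [RHS]big_seq.
apply: eq_bigr => t tp; rewrite big_mkcond (bigD1_seq t.2) //=; last first.
  by apply: sub; apply: map_f.
by rewrite eqxx big1 ?addr0 // => w wt; rewrite ifN // eq_sym.
Qed.

Lemma lin_fsum_eq p q : coefs_in S p -> coefs_in S q -> fsum_eq p q ->
  lin_fsum p = lin_fsum q.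
Proof.
move=> Sp Sq pq; pose s := undup [seq t.2 | t <- p ++ q].
have sp : {subset [seq t.2 | t <- p] <= s}.
  by move=> w wp; rewrite mem_undup map_cat mem_cat wp.
have sq : {subset [seq t.2 | t <- q] <= s}.
  by move=> w wp; rewrite mem_undup map_cat mem_cat wp orbT.
rewrite (lin_fsum_coef Sp _ sp) ?undup_uniq // (lin_fsum_coef Sq _ sq) ?undup_uniq //.
by apply: eq_bigr => w _; rewrite pq.
Qed.
End LinearExtension.

Section Evaluation.
Variables (R : comNzRingType) (S : R -> Prop) (Q : comNzRingType) (psi : R -> Q).
Variables (d : nat) (f : 'I_4 -> 'M[Q]_d).
Hypotheses (S0 : S 0) (SD : forall x y, S x -> S y -> S (x + y)).
Hypothesis SM : forall x y, S x -> S y -> S (x * y).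
Hypothesis S1 : S 1.
Hypothesis psiD : forall x y, S x -> S y -> psi (x + y) = psi x + psi y.
Hypothesis psiM : forall x y, S x -> S y -> psi (x * y) = psi x * psi y.
Hypothesis psi1 : psi 1 = 1.

Definition word_mx (w : word) : 'M[Q]_d := \prod_(l <- w) f l.
Definition eval_fsum (p : fsum R) : 'M[Q]_d := lin_fsum psi word_mx p.

Lemma word_mx_cat u v : word_mx (u ++ v) = word_mx u *m word_mx v.
Proof. by rewrite /word_mx big_cat. Qed.

Lemma eval_fsum_cat p q : eval_fsum (p ++ q) = eval_fsum p + eval_fsum q.
Proof. by rewrite /eval_fsum /lin_fsum big_cat. Qed.

Lemma eval_fsum_scale c p : S c -> coefs_in S p ->
  eval_fsum (fscale c p) = psi c *: eval_fsum p.
Proof.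
move=> Sc Sp; rewrite /eval_fsum /lin_fsum big_map scaler_sumr big_seq [RHS]big_seq.
by apply: eq_bigr => t tp; rewrite /= psiM ?scalerA //; apply: Sp.
Qed.

Lemma eval_fsum_word w : eval_fsum (fword R w) = word_mx w.
Proof. by rewrite /eval_fsum /lin_fsum big_seq1 psi1 scale1r. Qed.

Lemma coefs_in_scale c p : S c -> coefs_in S p -> coefs_in S (fscale c p).
Proof. by move=> Sc Sp t /mapP[u up ->]; apply: SM => //; apply: Sp. Qed.

Lemma coefs_in_cat p q : coefs_in S p -> coefs_in S q -> coefs_in S (p ++ q).
Proof. by move=> Sp Sq t; rewrite mem_cat => /orP[/Sp|/Sq]. Qed.

Lemma coefs_in_word w : coefs_in S (fword R w).
Proof. by move=> t; rewrite inE => /eqP->. Qed.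

Lemma coefs_in_mul p q : coefs_in S p -> coefs_in S q -> coefs_in S (fmul p q).
Proof.
by move=> Sp Sq t /allpairsP[[u v] [/= up vq ->]] /=; apply: SM; [apply: Sp|apply: Sq].
Qed.

Lemma coefs_in_flatten (r : seq (fsum R)) : (forall p, p \in r -> coefs_in S p) ->
  coefs_in S (flatten r).
Proof. by move=> h t /flattenP[p pr]; apply: h. Qed.

Lemma eval_fsum_mul p q : coefs_in S p -> coefs_in S q ->
  eval_fsum (fmul p q) = eval_fsum p *m eval_fsum q.
Proof.
move=> Sp Sq; rewrite /eval_fsum /lin_fsum /fmul big_allpairs_dep /= mulmx_suml big_seq [RHS]big_seq.
apply: eq_bigr => t tp; rewrite mulmx_sumr big_seq [RHS]big_seq.
apply: eq_bigr => u uq; rewrite psiM; [|exact: Sp|exact: Sq].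
by rewrite word_mx_cat -scalemxAl -scalemxAr scalerA.
Qed.

Lemma eval_in_ideal rels p : (forall r, r \in rels -> coefs_in S r /\ eval_fsum r = 0) ->
  coefs_in S p -> in_ideal S rels p -> eval_fsum p = 0.
Proof.
move=> hr Sp [r [hl pe]].
have Sterm x : x \in r -> coefs_in S (fscale x.1.1.1
    (fmul (fword R x.1.1.2) (fmul x.1.2 (fword R x.2)))).
  move=> /hl[Sx xr]; apply: coefs_in_scale => //; apply: coefs_in_mul.
    exact: coefs_in_word.
  by apply: coefs_in_mul; [have [] := hr _ xr | exact: coefs_in_word].
rewrite [LHS](lin_fsum_eq S0 SD psiD _ _ _ pe) //; last first.
  by apply: coefs_in_flatten => q /mapP[x xr ->]; apply: Sterm.
rewrite -[LHS]/(eval_fsum _).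
elim: r hl Sterm {pe} => [|x r IH] hl Sterm; first by rewrite /eval_fsum /lin_fsum big_nil.
rewrite /= eval_fsum_cat IH ?addr0; first last.
- by move=> y yr; apply: Sterm; rewrite inE yr orbT.
- by move=> y yr; apply: hl; rewrite inE yr orbT.
have [Sx xr] := hl x (mem_head _ _); have [Srx rx0] := hr _ xr.
rewrite eval_fsum_scale ?eval_fsum_mul //.
- by rewrite rx0 mul0mx mulmx0 scaler0.
- exact: coefs_in_word.
- exact: coefs_in_word.
- by apply: coefs_in_mul => //; apply: coefs_in_word.
- apply: coefs_in_mul; first exact: coefs_in_word.
  by apply: coefs_in_mul => //; apply: coefs_in_word.
Qed.
End Evaluation.

Lemma addr_div_exp (F : comUnitRingType) (x y a : F) m n : a \is a GRing.unit ->
  x / a ^+ m + y / a ^+ n = (x * a ^+ n + y * a ^+ m) / a ^+ (m + n).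
Proof.
move=> au; apply: (mulIr (unitrX (m + n) au)); rewrite divrK ?unitrX // mulrDl.
rewrite {1}addnC exprD {1}[a ^+ n * _]mulrC mulrA divrK ?unitrX //; congr (_ + _).
by rewrite addnC exprD mulrA divrK ?unitrX.
Qed.

(** * The ring R_k and its specialisations *)

Section CoefficientRing.
Variable k' : nat.
Notation k := k'.+1.
Notation a0 := (@param k ord0).

Lemma param_neq0 (j : 'I_k) : param j != 0.
Proof. by rewrite /param tofrac_eq0 -msupp_eq0 msuppX. Qed.

(** For k > 0 the index 0 exists, so the quantified denominator in [inRk] is a power of a_0. *)
Lemma inRkP (x : FracR k) : inRk x <-> exists p m, x = tofrac p / a0 ^+ m.
Proof.
split=> [[p [m h]]|[p [m ->]]]; first by exists p, m; apply: h.
by exists p, m => j0 j00; have -> : j0 = ord0 by apply: val_inj.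
Qed.

Lemma inRk_tofrac (p : Poly k) : inRk (tofrac p).
Proof. by apply/inRkP; exists p, 0%N; rewrite expr0 divr1. Qed.

Lemma inRk_param (j : 'I_k) : inRk (param j). Proof. exact: inRk_tofrac. Qed.

Lemma inRk_paramV : inRk (a0^-1).
Proof. by apply/inRkP; exists 1, 1%N; rewrite tofrac1 mul1r. Qed.

Lemma inRk0 : inRk (0 : FracR k). Proof. by rewrite -tofrac0; apply: inRk_tofrac. Qed.
Lemma inRk1 : inRk (1 : FracR k). Proof. by rewrite -tofrac1; apply: inRk_tofrac. Qed.

Lemma fracD (p q : Poly k) m n : tofrac p / a0 ^+ m + tofrac q / a0 ^+ n =
  tofrac (p * 'X_ord0 ^+ n + q * 'X_ord0 ^+ m) / a0 ^+ (m + n).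
Proof.
rewrite addr_div_exp ?unitfE ?param_neq0 // tofracD !tofracM !tofracXn.
by [].
Qed.

Lemma fracM (p q : Poly k) m n : (tofrac p / a0 ^+ m) * (tofrac q / a0 ^+ n) =
  tofrac (p * q) / a0 ^+ (m + n).
Proof. by rewrite tofracM exprD invfM mulrACA. Qed.

Lemma inRkD (x y : FracR k) : inRk x -> inRk y -> inRk (x + y).
Proof.
move=> /inRkP[p [m ->]] /inRkP[q [n ->]]; apply/inRkP.
by rewrite fracD; do 2!eexists.
Qed.

Lemma inRkM (x y : FracR k) : inRk x -> inRk y -> inRk (x * y).
Proof.
move=> /inRkP[p [m ->]] /inRkP[q [n ->]]; apply/inRkP.
by rewrite fracM; do 2!eexists.
Qed.

Section Specialization.
Variables (Q : comUnitRingType) (phi : {rmorphism {mpoly int[k]} -> Q}).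
Hypothesis phi0 : phi 'X_ord0 \is a GRing.unit.

(** A presentation p / a_0^m of x is picked by choice; [specE] shows that the value does not depend
    on it. *)
Definition spec (x : FracR k) : Q :=
  let pm := epsilon (inhabits (0 : Poly k, 0%N)) (fun pm => x = tofrac pm.1 / a0 ^+ pm.2) in
  phi pm.1 / phi 'X_ord0 ^+ pm.2.

Lemma specE p m : spec (tofrac p / a0 ^+ m) = phi p / phi 'X_ord0 ^+ m.
Proof.
rewrite /spec; set Pm := (fun _ => _); set pm := epsilon _ Pm.
have : Pm pm by apply: epsilon_spec; exists (p, m).
rewrite /Pm; clearbody pm.
move: pm => [q n] /= /eqP; rewrite eqr_div ?expf_neq0 ?param_neq0 //.
rewrite -!tofracXn -!tofracM tofrac_eq => /eqP/(congr1 phi); rewrite !rmorphM !rmorphXn => e.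
apply: (mulIr (unitrX m phi0)); apply: (mulIr (unitrX n phi0)).
rewrite divrK ?unitrX // e -mulrA [_ ^+ m * _]mulrC mulrA divrK ?unitrX //.
Qed.

Lemma specD x y : inRk x -> inRk y -> spec (x + y) = spec x + spec y.
Proof.
move=> /inRkP[p [m ->]] /inRkP[q [n ->]]; rewrite fracD !specE rmorphD !rmorphM !rmorphXn.
by rewrite addr_div_exp.
Qed.

Lemma specM x y : inRk x -> inRk y -> spec (x * y) = spec x * spec y.
Proof.
move=> /inRkP[p [m ->]] /inRkP[q [n ->]]; rewrite fracM !specE rmorphM.
by rewrite [RHS]mulrACA -invrM ?unitrX // -exprD [(n + m)%N]addnC.
Qed.

Lemma spec_tofrac p : spec (tofrac p) = phi p.
Proof. by have := specE p 0; rewrite !expr0 !divr1. Qed.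

Lemma spec1 : spec 1 = 1. Proof. by rewrite -tofrac1 spec_tofrac rmorph1. Qed.
Lemma specN1 : spec (-1) = -1.
Proof. by rewrite -tofrac1 -tofracN spec_tofrac rmorphN1. Qed.
End Specialization.
End CoefficientRing.

Section IrrSeparation.
Variables (gT : finGroupType) (G : {group gT}).
(** Multiply the relation by the inverse of the image of w j0, take traces and add them up weighted
    by the degrees. This gives the regular character, which vanishes away from 1 and so isolates c
    j0. *)
Lemma irr_separate N (w : 'I_N -> gT) (c : 'I_N -> algC) :
  injective w -> (forall j, w j \in G) ->
  (forall i : Iirr G, \sum_j c j *: 'Chi_i (w j) = 0) -> forall j, c j = 0.
Proof.
move=> winj wG h j0.
have e : \sum_j c j * cfReg G (w j * (w j0)^-1)%g = 0.
  rewrite cfReg_sum.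
  transitivity (\sum_i 'chi[G]_i 1%g * \tr ((\sum_j c j *: 'Chi_i (w j)) *m 'Chi_i (w j0)^-1%g)).
    under [RHS]eq_bigr do rewrite mulmx_suml raddf_sum mulr_sumr.
    rewrite exchange_big; apply: eq_bigr => j _.
    rewrite sum_cfunE mulr_sumr; apply: eq_bigr => i _.
    rewrite cfunE /= -scalemxAl mxtraceZ -repr_mxM ?groupV //.
    rewrite -{2}irrRepr cfunE groupM ?groupV // mulr1n.
    by rewrite mulrCA.
  by rewrite big1 // => i _; rewrite h mul0mx mxtrace0 mulr0.
move: e; rewrite (bigD1 j0) //= big1 ?addr0.
  rewrite mulgV cfRegE eqxx mulr1n => /eqP; rewrite mulf_eq0 => /orP[/eqP//|].
  by rewrite pnatr_eq0 eqn0Ngt cardG_gt0.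
by move=> j jj0; rewrite cfRegE -eq_mulgV1 (inj_eq winj) (negPf jj0) mulr0.
Qed.
End IrrSeparation.

Definition word_grp (gT : finGroupType) (s1 s2 : gT) (w : word) : gT :=
  (\prod_(l <- w) letter_val s1 s2 s1^-1 s2^-1 l)%g.

Section HeckeRelations.
Variables (k' : nat) (Q : comUnitRingType) (phi : {rmorphism {mpoly int[k'.+1]} -> Q}).
Notation k := k'.+1.
Hypothesis phi0 : phi 'X_ord0 \is a GRing.unit.
Variables (d : nat) (S T : 'M[Q]_d).
Hypotheses (Su : S \in unitmx) (Tu : T \in unitmx) (STS : S *m T *m S = T *m S *m T).
Hypothesis Sk : S ^+ k = \sum_(j < k) phi 'X_j *: S ^+ j.
Hypothesis Tk : T ^+ k = \sum_(j < k) phi 'X_j *: T ^+ j.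
Let f := letter_val S T (invmx S) (invmx T).
Notation ev := (eval_fsum (spec phi) f).

Let S0 := @inRk0 k'. Let SD := @inRkD k'. Let SM := @inRkM k'. Let S1 := @inRk1 k'.
Let psiD := specD phi0. Let psiM := specM phi0. Let psi1 := spec1 phi0.

Lemma inRkN1 : inRk (-1 : FracR k).
Proof. by rewrite -tofrac1 -tofracN; apply: inRk_tofrac. Qed.

Lemma coefs_in_sub (p q : fsum (FracR k)) : coefs_in (@inRk k) p -> coefs_in (@inRk k) q ->
  coefs_in (@inRk k) (fsub p q).
Proof.
by move=> Sp Sq; apply: coefs_in_cat => //; apply: coefs_in_scale => //; apply: inRkN1.
Qed.

Lemma eval_fsub p q : coefs_in (@inRk k) q -> ev (fsub p q) = ev p - ev q.
Proof.
move=> Sq; rewrite /fsub eval_fsum_cat (eval_fsum_scale _ psiM) //; last exact: inRkN1.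
by rewrite specN1 // scaleN1r.
Qed.

Lemma word_mx_nseq n l : word_mx f (nseq n l) = f l ^+ n.
Proof. by rewrite /word_mx big_nseq -Monoid.iteropE. Qed.

Lemma coefs_in_hecke l : coefs_in (@inRk k) (hecke_rel k l).
Proof.
apply: coefs_in_sub; first exact: coefs_in_word.
by move=> t /mapP[j _ ->]; apply: inRk_param.
Qed.

Lemma eval_hecke l : f l ^+ k = \sum_(j < k) phi 'X_j *: f l ^+ j -> ev (hecke_rel k l) = 0.
Proof.
move=> h; rewrite /hecke_rel eval_fsub; last by move=> t /mapP[j _ ->]; apply: inRk_param.
rewrite (eval_fsum_word _ psi1) word_mx_nseq h /eval_fsum /lin_fsum big_map big_enum /=.
apply/eqP; rewrite subr_eq0; apply/eqP/eq_bigr => j _.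
by rewrite word_mx_nseq /param spec_tofrac.
Qed.

Lemma eval_Hk_rels r : r \in Hk_rels k -> coefs_in (@inRk k) r /\ ev r = 0.
Proof.
have two u v : word_mx f u = word_mx f v ->
    coefs_in (@inRk k) (fsub (fword _ u) (fword _ v)) /\
    ev (fsub (fword _ u) (fword _ v)) = 0.
  move=> uv; split; first by apply: coefs_in_sub; apply: coefs_in_word.
  rewrite eval_fsub; last exact: coefs_in_word.
  by rewrite !(eval_fsum_word _ psi1) uv subrr.
have w2 x y : word_mx f [:: x; y] = f x *m f y.
  by rewrite /word_mx !big_cons big_nil mulr1.
have w3 x y z : word_mx f [:: x; y; z] = f x *m f y *m f z.
  by rewrite /word_mx !big_cons big_nil mulr1 mulrA.
have w0 : word_mx f [::] = 1%:M by rewrite /word_mx big_nil.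
rewrite !inE => /orP[/eqP->|/orP[/eqP->|/orP[/eqP->|/orP[/eqP->|/orP[/eqP->|/orP[/eqP->|/eqP->]]]]]].
- by apply: two; rewrite w2 w0 /f !letter_valE mulmxV.
- by apply: two; rewrite w2 w0 /f !letter_valE mulVmx.
- by apply: two; rewrite w2 w0 /f !letter_valE mulmxV.
- by apply: two; rewrite w2 w0 /f !letter_valE mulVmx.
- by apply: two; rewrite !w3 /f !letter_valE.
- by split; [exact: coefs_in_hecke | apply: eval_hecke; rewrite /f letter_valE].
- by split; [exact: coefs_in_hecke | apply: eval_hecke; rewrite /f letter_valE].
Qed.

Lemma eval_relation N (bw : 'I_N -> word) (c : 'I_N -> FracR k) :
  (forall i, inRk (c i)) ->
  in_ideal (@inRk k) (Hk_rels k) (flin c (fun i => fword _ (bw i))) ->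
  \sum_i spec phi (c i) *: word_mx f (bw i) = 0.
Proof.
move=> Sc id.
have Sfl : coefs_in (@inRk k) (flin c (fun i => fword _ (bw i))).
  apply: coefs_in_flatten => p /mapP[i _ ->]; apply: coefs_in_scale => //.
  exact: coefs_in_word.
have := eval_in_ideal S0 SD SM S1 psiD psiM eval_Hk_rels Sfl id.
rewrite /flin /eval_fsum /lin_fsum big_flatten big_map big_enum /= => e; rewrite -[RHS]e.
by apply: eq_bigr => i _; rewrite big_seq1 /= mulr1.
Qed.
End HeckeRelations.

Theorem words_independent (gT : finGroupType) (s1 s2 : gT) (k' N : nat)
    (bw : 'I_N -> word) (c : 'I_N -> FracR k'.+1) :
  (s1 * s2 * s1 = s2 * s1 * s2)%g -> (s1 ^+ k'.+1 = 1)%g ->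
  injective (fun i => word_grp s1 s2 (bw i)) ->
  (forall i, inRk (c i)) ->
  in_ideal (@inRk k'.+1) (Hk_rels k'.+1) (flin c (fun i => fword _ (bw i))) ->
  forall i, c i = 0.
Proof.
move=> braid s1k winj Sc id i0; apply/eqP; apply/negPn/negP => ci0.
have [zeta zetaP] := C_prim_root_exists (ltn0Sn k').
have zn0 : zeta != 0.
  apply/eqP => z0; have := prim_expr_order zetaP.
  by rewrite z0 expr0n /= => /eqP; rewrite eq_sym oner_eq0.
pose G : {group gT} := <<[set s1; s2]>>%G.
pose deg (i : Iirr G) := irr_degree (socle_of_Iirr i).
(* A common multiple of all degrees lets one curve serve every irreducible representation. *)
pose N0 := (\prod_(i : Iirr G) deg i)%N.
have N0_gt0 : (0 < N0)%N by apply: prodn_gt0 => i; apply: irr_degree_gt0.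
have [pm pmE] : exists pm : 'I_N -> Poly k'.+1 * nat,
    forall i, c i = tofrac (pm i).1 / (@param k'.+1 ord0) ^+ (pm i).2.
  apply: (@fin_all_exists _ (fun=> (Poly k'.+1 * nat)%type)
    (fun i x => c i = tofrac x.1 / (@param k'.+1 ord0) ^+ x.2)) => i.
  by have /inRkP[p [m e]] := Sc i; exists (p, m).
(* Clearing denominators: P i = c i * a_0^mm is a polynomial. *)
pose mm := (\sum_i (pm i).2)%N.
pose P i : Poly k'.+1 := (pm i).1 * 'X_ord0 ^+ (mm - (pm i).2).
have le_mm i : ((pm i).2 <= mm)%N by rewrite /mm (bigD1 i) //= leq_addr.
have Pi0 : P i0 != 0.
  apply: mulf_neq0; last by apply: expf_neq0; rewrite -msupp_eq0 msuppX.
  by apply: contraNneq ci0 => p0; rewrite pmE p0 tofrac0 mul0r.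
have [x phx] := path_exists zn0 N0_gt0 Pi0.
pose ph : {rmorphism {mpoly int[k'.+1]} -> {poly algC}} :=
  mmap (intr : int -> {poly algC}) (hecke_coef (root_path zeta x N0)).
(* The least such n is the lowest order in X at which some numerator is nonzero along the curve.
   Modulo X^(n+1) every numerator becomes a constant times t^n. *)
have exn : exists n, [exists i, (ph (P i))`_n != 0].
  exists (size (ph (P i0))).-1; apply/existsP; exists i0.
  by rewrite -lead_coefE lead_coef_eq0.
have [n /existsP[i1 ni1] nmin] := ex_minnP exn.
pose phi : {rmorphism {mpoly int[k'.+1]} -> tpoly algC n} := (@qin algC n \o ph)%FUN.
have phiX (j : 'I_k'.+1) : phi 'X_j = qin n (hecke_coef (root_path zeta x N0) j).
  by rewrite /phi /= mmapX mmap1U.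
have phi0 : phi 'X_ord0 \is a GRing.unit.
  apply: (eps_unit (@qiotaK algC n) (@qeps_ker algC n) (@qt_nil algC n)).
  (* Up to sign a_0 is the product of the roots, which at X = 0 are powers of zeta. *)
  have e0 : (root_poly (root_path zeta x N0))`_0 = \prod_j (- root_path zeta x N0 j).
    rewrite -horner_coef0 /root_poly horner_prod; apply: eq_bigr => j _.
    by rewrite hornerXsubC sub0r.
  rewrite phiX /= qeps_in /hecke_coef coefN oppr_eq0 e0 -horner_coef0 horner_prod.
  apply/prodf_neq0 => j _.
  by rewrite hornerN oppr_eq0 horner_coef0 root_path0 expf_neq0.
have lG (l : 'I_4) : letter_val s1 s2 s1^-1%g s2^-1%g l \in G.
  have [G1 G2] := (gen_s1 s1 s2, gen_s2 s1 s2).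
  by case: l => [[|[|[|[|]]]]] //= lt4; rewrite /letter_val /= ?groupV.
have wG w : word_grp s1 s2 w \in G by apply: group_prod => l _; apply: lG.
have eP j : phi (P j) = phi 'X_ord0 ^+ mm * spec phi (c j).
  rewrite pmE specE // [phi (P j)]rmorphM [phi (_ ^+ _)]rmorphXn.
  rewrite -{2}(subnK (le_mm j)) exprD [phi _ / _]mulrC mulrA mulrK ?unitrX //.
  by rewrite mulrC.
have eL j : phi (P j) = qt algC n ^+ n * qiota n (ph (P j))`_n.
  apply: qin_lead => m mn; apply/eqP; apply: contraTT mn => nz; rewrite -leqNgt.
  by apply: nmin; apply/existsP; exists j.
clearbody phi.
have relC (i : Iirr G) : \sum_j (ph (P j))`_n *: 'Chi_i (word_grp s1 s2 (bw j)) = 0.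
  have [||S [T [[Su Tu] STS Sk Tk [S0 T0]]]] :=
    @deform_irr _ s1 s2 _ braid s1k zeta x N0 n zetaP _ 'Chi_i.
  - exact: socle_irr.
  - by rewrite /N0 (bigD1 i) //= dvdn_mulr.
  have Sk' : S ^+ k'.+1 = \sum_(j < k'.+1) phi 'X_j *: S ^+ j.
    by rewrite Sk; apply: eq_bigr => j _; rewrite phiX.
  have Tk' : T ^+ k'.+1 = \sum_(j < k'.+1) phi 'X_j *: T ^+ j.
    by rewrite Tk; apply: eq_bigr => j _; rewrite phiX.
  have rel := eval_relation phi0 Su Tu STS Sk' Tk' Sc id.
  set f := letter_val S T _ _ in rel.
  have fE l : map_mx (@qeps algC n) (f l) = 'Chi_i (letter_val s1 s2 s1^-1%g s2^-1%g l).
    have [G1 G2] := (gen_s1 s1 s2, gen_s2 s1 s2).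
    case: l => [[|[|[|[|]]]]] //= lt4; rewrite /f /letter_val /=.
    - by rewrite qeps_invmx // S0 repr_mxV.
    - by rewrite qeps_invmx // T0 repr_mxV.
  have Wm w : map_mx (@qeps algC n) (word_mx f w) = 'Chi_i (word_grp s1 s2 w).
    elim: w => [|l w IH]; first by rewrite /word_mx /word_grp !big_nil map_mx1 repr_mx1.
    rewrite /word_grp big_cons repr_mxM //; last exact: wG.
    by rewrite -[X in _ *m 'Chi_i X]/(word_grp s1 s2 w) -IH -fE -map_mxM /word_mx big_cons.
  have rel2 : \sum_j phi (P j) *: word_mx f (bw j) = 0.
    under eq_bigr do rewrite eP -scalerA.
    by rewrite -scaler_sumr rel scaler0.
  apply/matrixP => r s; move/matrixP/(_ r s): rel2; rewrite !summxE => rel2.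
  rewrite [RHS]mxE.
  (* The common factor t^n cancels modulo t, leaving a relation between values of the undeformed
     representation. *)
  have : qeps (\sum_j qiota n (ph (P j))`_n * word_mx f (bw j) r s) = 0.
    apply: (qt_reg (ltnSn n) (y := 0)); rewrite mulr0 mulr_sumr.
    move: rel2; rewrite [X in _ = X -> _]mxE => rel2; rewrite -[RHS]rel2.
    by apply: eq_bigr => j _; rewrite mxE eL mulrA.
  rewrite rmorph_sum => e; rewrite -[RHS]e; apply: eq_bigr => j _.
  by rewrite rmorphM /= qiotaK mxE -Wm mxE.
by move/eqP: ni1; apply; apply: (irr_separate winj _ relC i1) => j; apply: wG.
Qed.

(** * Normal forms in the braid group *)

Local Close Scope ring_scope.

(* A signed letter is (generator, inverted?), with false = a and true = b. *)
Definition sword := seq (bool * bool).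

(* [(e, w)] encodes Delta^e times the positive word [rev w]. *)
Definition garside := (int * seq bool)%type.

Definition int_succ (e : int) : int :=
  match e with Posz n => Posz n.+1 | Negz 0 => Posz 0 | Negz n.+1 => Negz n end.
Definition int_pred (e : int) : int :=
  match e with Posz 0 => Negz 0 | Posz n.+1 => Posz n | Negz n => Negz n.+1 end.

(** The word is stored reversed, so its head is the last letter. Appending x after x y, with y the
    other generator, completes Delta = x y x, which moves to the front and exchanges a and b in the
    rest. A positive word with no factor aba or bab admits no braid move; this makes the form
    unique. *)
Definition gpos (n : garside) (x : bool) : garside :=
  match n.2 with
  | y :: x' :: w => if (y != x) && (x' == x) then (int_succ n.1, map negb w) else (n.1, x :: n.2)
  | _ => (n.1, x :: n.2)
  end.

(** Unless the last letter cancels, x^-1 is written y x Delta^-1 with y the other generator, and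
    Delta^-1 moves to the front. *)
Definition gneg (n : garside) (x : bool) : garside :=
  let long := let m := gpos (gpos n (~~ x)) x in (int_pred m.1, map negb m.2) in
  match n.2 with
  | y :: w => if y == x then (n.1, w) else long
  | _ => long
  end.

Definition gmul (n : garside) (s : bool * bool) : garside :=
  if s.2 then gneg n s.1 else gpos n s.1.

Definition gnf (n : garside) (s : sword) : garside := foldl gmul n s.

Definition apow (i : Z) : sword := nseq (Z.abs_nat i) (false, Z.ltb i Z0).

(** Right multiplication of [p q; r t] by the image of s in SL_2(Z), where a = [1 1; 0 1] and b =
    [1 0; -1 1]. *)
Fixpoint smat (s : sword) (p q r t : Z) : Z * Z * Z * Z :=
  match s with
  | [::] => (p, q, r, t)
  | (g, v) :: s' =>
    let e := if v then Zneg 1 else Zpos 1 in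
    if g then smat s' (Z.sub p (Z.mul e q)) q (Z.sub r (Z.mul e t)) t
    else smat s' p (Z.add q (Z.mul e p)) r (Z.add t (Z.mul e r))
  end.

(* Left and right powers of a to strip, so that equal double cosets of <a> get equal keys: *)
(* in the image [p q; r t] in SL_2(Z) they reduce p and t modulo r. *)
Definition strip (s : sword) : Z * Z :=
  let: (p, q, r, t) := smat s (Zpos 1) Z0 Z0 (Zpos 1) in
  if Z.eqb r Z0 then (Z.mul q p, Z0) else (Z.div p r, Z.div t r).

(** The key of z^m s. It starts from exponent m + m because z = (ab)^3 = Delta^2. *)
Definition gkey (m : int) (s : sword) : garside :=
  let: (i, j) := strip s in
  gnf ((m + m)%R, [::]) (apow (Z.opp i) ++ s ++ apow (Z.opp j)).

(** * Soundness of the normal forms for any congruence containing the braid group relations *)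

Section Soundness.
Variables (T : Type) (eqv : seq T -> seq T -> Prop).
Hypothesis eqv_refl : forall u, eqv u u.
Hypothesis eqv_sym : forall u v, eqv u v -> eqv v u.
Hypothesis eqv_trans : forall v u w, eqv u v -> eqv v w -> eqv u w.
Hypothesis eqv_ctx : forall x y u v, eqv u v -> eqv (x ++ u ++ y) (x ++ v ++ y).
Variable lt : bool * bool -> T.
Hypothesis lt_cancel : forall g v, eqv [:: lt (g, v); lt (g, ~~ v)] [::].
Hypothesis lt_braid : eqv [:: lt (false, false); lt (true, false); lt (false, false)]
  [:: lt (true, false); lt (false, false); lt (true, false)].

Definition tow (s : sword) : seq T := map lt s.
Let P (w : seq bool) : seq T := [seq lt (x, false) | x <- w].
Definition Delta : sword := [:: (false, false); (true, false); (false, false)].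
Definition DeltaV : sword := [:: (false, true); (true, true); (false, true)].
Definition dpow (e : int) : sword :=
  match e with Posz n => flatten (nseq n Delta) | Negz n => flatten (nseq n.+1 DeltaV) end.
Definition gword (n : garside) : seq T := tow (dpow n.1) ++ P (rev n.2).

Lemma eqv_cat u u' v v' : eqv u u' -> eqv v v' -> eqv (u ++ v) (u' ++ v').
Proof.
move=> h1 h2; apply: (@eqv_trans (u' ++ v)).
  by have := eqv_ctx [::] v h1.
by have := eqv_ctx u' [::] h2; rewrite !cats0.
Qed.
Lemma eqv_catl x u v : eqv u v -> eqv (x ++ u) (x ++ v).
Proof. by move=> h; apply: eqv_cat. Qed.
Lemma eqv_catr y u v : eqv u v -> eqv (u ++ y) (v ++ y).
Proof. by move=> h; apply: eqv_cat. Qed.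

Let D := tow Delta. Let DV := tow DeltaV.

Lemma D_alt x : eqv (P [:: x; ~~ x; x]) D.
Proof. by case: x => //=; apply: eqv_sym. Qed.

(** With y the other generator, x Delta = x (y x y) = (x y x) y = Delta y. *)
Lemma P_D w : eqv (P w ++ D) (D ++ P (map negb w)).
Proof.
elim: w => [|x w IH]; first by rewrite cats0; apply: eqv_refl.
apply: (@eqv_trans ([:: lt (x, false)] ++ D ++ P (map negb w))).
  by rewrite -[P (x :: w)]/([:: lt (x, false)] ++ P w) -catA; apply: eqv_catl.
rewrite !catA; apply: (@eqv_trans ((D ++ [:: lt (~~ x, false)]) ++ P (map negb w))); last first.
  by rewrite -catA; apply: eqv_refl.
apply: eqv_catr.
apply: (@eqv_trans (P [:: x; ~~ x; x; ~~ x])).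
  rewrite -[P _]/([:: lt (x, false)] ++ P [:: ~~ x; x; ~~ x]); apply: eqv_catl.
  by apply: eqv_sym; have := D_alt (~~ x); rewrite negbK.
by rewrite -[P _]/(P [:: x; ~~ x; x] ++ [:: lt (~~ x, false)]); apply: eqv_catr; apply: D_alt.
Qed.

Lemma DV_D : eqv (DV ++ D) [::].
Proof.
have c x u v : eqv (u ++ [:: lt (x, true); lt (x, false)] ++ v) (u ++ v).
  by have := eqv_ctx u v (lt_cancel x true).
apply: (eqv_trans (c false [:: lt (false, true); lt (true, true)] [:: lt (true, false); lt (false, false)])).
apply: (eqv_trans (c true [:: lt (false, true)] [:: lt (false, false)])).
exact: (c false [::] [::]).
Qed.

Lemma D_DV : eqv (D ++ DV) [::].
Proof.
have c x u v : eqv (u ++ [:: lt (x, false); lt (x, true)] ++ v) (u ++ v).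
  by have := eqv_ctx u v (lt_cancel x false).
apply: (eqv_trans (c false [:: lt (false, false); lt (true, false)] [:: lt (true, true); lt (false, true)])).
apply: (eqv_trans (c true [:: lt (false, false)] [:: lt (false, true)])).
exact: (c false [::] [::]).
Qed.

Lemma P_DV w : eqv (P w ++ DV) (DV ++ P (map negb w)).
Proof.
have e : eqv (DV ++ (P (map negb w) ++ D) ++ DV) (DV ++ (D ++ P w) ++ DV).
  by have := eqv_ctx DV DV (P_D (map negb w)); rewrite (mapK negbK).
apply: (@eqv_trans (DV ++ (D ++ P w) ++ DV)).
  apply: eqv_sym; rewrite !catA; apply: eqv_catr.
  by have := eqv_catr (P w) DV_D.
apply: (eqv_trans (eqv_sym e)); rewrite -!catA; apply: eqv_catl.
by have := eqv_catl (P (map negb w)) D_DV; rewrite cats0.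
Qed.

Lemma flatten_nseqS (n : nat) (s : sword) : flatten (nseq n.+1 s) = flatten (nseq n s) ++ s.
Proof. by elim: n => [|n IH] /=; rewrite ?cats0 // -catA -IH. Qed.

Lemma tow_cat u v : tow (u ++ v) = tow u ++ tow v. Proof. exact: map_cat. Qed.

Lemma dpow_succ e : eqv (tow (dpow e) ++ D) (tow (dpow (int_succ e))).
Proof.
case: e => [n|[|n]].
- have -> : dpow (int_succ n) = dpow n ++ Delta := flatten_nseqS n Delta.
  by rewrite tow_cat; apply: eqv_refl.
- exact: DV_D.
have -> : dpow (Negz n.+1) = dpow (Negz n) ++ DeltaV := flatten_nseqS n.+1 DeltaV.
rewrite tow_cat -catA.
by have := eqv_catl (tow (dpow (Negz n))) DV_D; rewrite cats0.
Qed.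

Lemma dpow_pred e : eqv (tow (dpow e) ++ DV) (tow (dpow (int_pred e))).
Proof.
case: e => [[|n]|n].
- exact: eqv_refl.
- have -> : dpow (Posz n.+1) = dpow n ++ Delta := flatten_nseqS n Delta.
  by rewrite tow_cat -catA; have := eqv_catl (tow (dpow n)) D_DV; rewrite cats0.
have -> : dpow (int_pred (Negz n)) = dpow (Negz n) ++ DeltaV := flatten_nseqS n.+1 DeltaV.
by rewrite tow_cat; apply: eqv_refl.
Qed.

Lemma P_cat u v : P (u ++ v) = P u ++ P v. Proof. exact: map_cat. Qed.

Lemma gpos_sound n x : eqv (gword n ++ [:: lt (x, false)]) (gword (gpos n x)).
Proof.
case: n => e w; rewrite /gpos /gword /=.
have triv v : eqv ((tow (dpow e) ++ P (rev v)) ++ [:: lt (x, false)])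
   (tow (dpow e) ++ P (rev (x :: v))).
  by rewrite rev_cons -cats1 P_cat catA; apply: eqv_refl.
case: w => [|y [|x' w]]; try exact: triv.
case: ifP => [/andP[yx /eqP->]|_]; last exact: triv.
have -> : y = ~~ x by case: (x) (y) yx => [] [].
rewrite !rev_cons -!cats1 !P_cat -!catA /=.
apply: (@eqv_trans (tow (dpow e) ++ P (rev w) ++ D)).
  by do 2!apply: eqv_catl; apply: D_alt.
apply: (@eqv_trans (tow (dpow e) ++ D ++ P (map negb (rev w)))).
  by apply: eqv_catl; apply: P_D.
by rewrite map_rev catA; apply: eqv_catr; apply: dpow_succ.
Qed.

Lemma gneg_sound n x : eqv (gword n ++ [:: lt (x, true)]) (gword (gneg n x)).
Proof.
have long : eqv (gword n ++ [:: lt (x, true)])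
    (gword (let m := gpos (gpos n (~~ x)) x in (int_pred m.1, map negb m.2))).
  set m := gpos _ x => /=.
  have hm : eqv (gword n ++ P [:: ~~ x; x]) (gword m).
    have := eqv_catr [:: lt (x, false)] (gpos_sound n (~~ x)); rewrite -catA => h.
    exact: (eqv_trans h (gpos_sound _ _)).
  apply: (@eqv_trans (gword m ++ DV)); last first.
    rewrite /gword /= -catA -map_rev.
    apply: (@eqv_trans (tow (dpow m.1) ++ DV ++ P (map negb (rev m.2)))).
      by apply: eqv_catl; apply: P_DV.
    by rewrite catA; apply: eqv_catr; apply: dpow_pred.
  apply: (@eqv_trans ((gword n ++ P [:: ~~ x; x]) ++ DV)); last exact: eqv_catr.
  rewrite -catA; apply: eqv_catl.
  apply: (@eqv_trans ([:: lt (x, true)] ++ D ++ DV)).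
    by have := eqv_catl [:: lt (x, true)] (eqv_sym D_DV).
  rewrite catA; apply: eqv_catr.
  apply: (@eqv_trans ([:: lt (x, true)] ++ P [:: x; ~~ x; x])).
    by apply: eqv_catl; apply: eqv_sym; apply: D_alt.
  by have := eqv_catr (P [:: ~~ x; x]) (lt_cancel x true).
case: n long => e [|y w] long //; rewrite /gneg /=; case: eqP => [->|_] //.
rewrite /gword /= rev_cons -cats1 P_cat -!catA; apply: eqv_catl.
by have := eqv_catl (P (rev w)) (lt_cancel x false); rewrite cats0.
Qed.

Lemma gnf_sound n s : eqv (gword n ++ tow s) (gword (gnf n s)).
Proof.
elim: s n => [|[g v] s IH] n /=; first by rewrite cats0; apply: eqv_refl.
rewrite -cat1s catA; apply: eqv_trans (IH _); apply: eqv_catr.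
by rewrite /gmul /=; case: v; [apply: gneg_sound | apply: gpos_sound].
Qed.

(** Passing Delta or its inverse twice exchanges the generators twice, so even powers commute with a
    and b, hence with their inverses. *)
Lemma dpow_even_central m s : eqv (tow (dpow (m + m)%R) ++ tow s) (tow s ++ tow (dpow (m + m)%R)).
Proof.
have cP (X : seq T) (hX : forall w, eqv (P w ++ X) (X ++ P (map negb w))) j w :
    eqv (P w ++ flatten (nseq (j + j) X)) (flatten (nseq (j + j) X) ++ P w).
  elim: j => [|j IH]; first by rewrite cats0; apply: eqv_refl.
  rewrite addSn addnS /= !catA.
  apply: (@eqv_trans (((X ++ P (map negb w)) ++ X) ++ flatten (nseq (j + j) X))).
    by do 2!apply: eqv_catr; apply: hX.
  apply: (@eqv_trans ((X ++ (X ++ P w)) ++ flatten (nseq (j + j) X))).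
    by apply: eqv_catr; rewrite -catA; apply: eqv_catl; have := hX (map negb w); rewrite (mapK negbK).
  by rewrite -!catA; do 2!apply: eqv_catl.
have tf n X : tow (flatten (nseq n X)) = flatten (nseq n (tow X)).
  by elim: n => //= n IH; rewrite tow_cat IH.
have c1 g : eqv ([:: lt (g, false)] ++ tow (dpow (m + m)%R)) (tow (dpow (m + m)%R) ++ [:: lt (g, false)]).
  case: m => n.
    rewrite -[(_ + _)%R]/(Posz (n + n)) [dpow _]/= tf.
    exact: (cP D P_D n [:: g]).
  have -> : dpow (Negz n + Negz n)%R = flatten (nseq (n.+1 + n.+1) DeltaV).
    by rewrite addSn addnS.
  by rewrite tf; exact: (cP DV P_DV n.+1 [:: g]).
elim: s => [|[g v] s IH]; first by rewrite cats0; apply: eqv_refl.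
have c2 : eqv ([:: lt (g, v)] ++ tow (dpow (m + m)%R)) (tow (dpow (m + m)%R) ++ [:: lt (g, v)]).
  case: v; last exact: c1.
  set z := tow (dpow _).
  apply: (@eqv_trans ([:: lt (g, true)] ++ z ++ [:: lt (g, false); lt (g, true)])).
    by apply: eqv_catl; have := eqv_catl z (eqv_sym (lt_cancel g false)); rewrite cats0.
  apply: (@eqv_trans ([:: lt (g, true)] ++ (([:: lt (g, false)] ++ z) ++ [:: lt (g, true)]))).
    apply: eqv_catl; rewrite -[_ :: _]/([:: lt (g, false)] ++ [:: lt (g, true)]) catA.
    by apply: eqv_catr; apply: eqv_sym; apply: c1.
  by rewrite -!catA catA; have := eqv_catr (z ++ [:: lt (g, true)]) (lt_cancel g true).
rewrite -[tow (_ :: s)]/([:: lt (g, v)] ++ tow s) catA.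
apply: (@eqv_trans (([:: lt (g, v)] ++ tow (dpow (m + m)%R)) ++ tow s)).
  by apply: eqv_catr; apply: eqv_sym.
by rewrite -!catA; apply: eqv_catl.
Qed.

Lemma apow_cancel i : eqv (tow (apow i) ++ tow (apow (Z.opp i))) [::].
Proof.
have h n g v : eqv (tow (nseq n (g, v)) ++ tow (nseq n (g, ~~ v))) [::].
  elim: n => [|n IH]; first exact: eqv_refl.
  have -> : tow (nseq n.+1 (g, ~~ v)) = tow (nseq n (g, ~~ v)) ++ [:: lt (g, ~~ v)].
    by rewrite -(addn1 n) nseqD tow_cat.
  rewrite -[tow (nseq n.+1 (g, v))]/([:: lt (g, v)] ++ tow (nseq n (g, v))) -catA.
  rewrite [tow _ ++ _]catA.
  apply: eqv_trans (lt_cancel g v).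
  by have := eqv_ctx [:: lt (g, v)] [:: lt (g, ~~ v)] IH.
rewrite /apow.
have -> : Z.abs_nat (Z.opp i) = Z.abs_nat i by case: (i).
case: i => [|p|p]; [exact: eqv_refl | exact: (h _ false false) | exact: (h _ false true)].
Qed.

(** This holds whatever exponents [strip] returns: a^i and a^j are removed before normalisation and
    put back here. A poor choice could only make two keys differ. *)
Lemma gkey_sound m s : let: (i, j) := strip s in
  eqv (tow (dpow (m + m)%R) ++ tow s) (tow (apow i) ++ gword (gkey m s) ++ tow (apow j)).
Proof.
rewrite /gkey; case: (strip s) => i j.
have := gnf_sound ((m + m)%R, [::]) (apow (Z.opp i) ++ s ++ apow (Z.opp j)).
rewrite /gword /= cats0 !tow_cat => h.
apply: (@eqv_trans (tow (apow i) ++ (tow (dpow (m + m)%R) ++ tow (apow (Z.opp i)) ++ tow s ++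
  tow (apow (Z.opp j))) ++ tow (apow j))); last first.
  by apply: eqv_ctx.
have cj : eqv (tow (apow (Z.opp j)) ++ tow (apow j)) [::].
  by have := apow_cancel (Z.opp j); rewrite Z.opp_involutive.
set z := tow (dpow _).
apply: (@eqv_trans (tow (apow i) ++ (tow (apow (Z.opp i)) ++ z) ++ tow s)).
  by rewrite !catA -[X in eqv X _]cat0s catA; do 2!apply: eqv_catr; apply: eqv_sym; apply: apow_cancel.
apply: eqv_catl; apply: (@eqv_trans ((z ++ tow (apow (Z.opp i))) ++ tow s)).
  by apply: eqv_catr; apply: eqv_sym; apply: dpow_even_central.
rewrite -!catA; do 2!apply: eqv_catl.
by have := eqv_catl (tow s) (eqv_sym cj); rewrite cats0.
Qed.
End Soundness.

Local Open Scope ring_scope.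

(** * Spanning *)

Section Ideal.
Variables (R : comNzRingType) (S : R -> Prop).
Hypotheses (S1 : S 1) (SM : forall x y, S x -> S y -> S (x * y)).
Variable rels : seq (fsum R).
Notation idl := (in_ideal S rels).

Lemma coef_cat (p q : fsum R) w : coef (p ++ q) w = coef p w + coef q w.
Proof. by rewrite /coef big_cat. Qed.

Lemma coef_scale c (p : fsum R) w : coef (fscale c p) w = c * coef p w.
Proof. by rewrite /coef big_map mulr_sumr. Qed.

Lemma coef_sub (p q : fsum R) w : coef (fsub p q) w = coef p w - coef q w.
Proof. by rewrite coef_cat coef_scale mulN1r. Qed.

Lemma coef_cons (t : R * word) (p : fsum R) w :
  coef (t :: p) w = t.1 * (t.2 == w)%:R + coef p w.
Proof. by rewrite /coef big_cons; case: eqP; rewrite ?mulr1 // mulr0 add0r. Qed.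

Lemma coef_word u w : coef (fword R u) w = (u == w)%:R.
Proof. by rewrite coef_cons /coef big_nil addr0 mul1r. Qed.

Lemma fmul_ctx (p : fsum R) x y :
  fmul (fword R x) (fmul p (fword R y)) = [seq (t.1, x ++ t.2 ++ y) | t <- p].
Proof.
have -> : fmul p (fword R y) = [seq (t.1, t.2 ++ y) | t <- p].
  elim: p => //= t p IH; rewrite [LHS]/= -IH /fmul /=.
  by rewrite mulr1.
rewrite /fmul /= cats0 -map_comp; apply: eq_map => t /=; by rewrite mul1r.
Qed.

(** Each coefficient after concatenation is a linear functional of the formal sum, so [lin_fsum_eq],
    with everything as the subring, applies. *)
Lemma coef_ctx (p q : fsum R) x y : fsum_eq p q ->
  fsum_eq [seq (t.1, x ++ t.2 ++ y) | t <- p] [seq (t.1, x ++ t.2 ++ y) | t <- q].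
Proof.
move=> pq w; rewrite /coef !big_map /=.
have h (r : fsum R) : \sum_(t <- r | x ++ t.2 ++ y == w) t.1 =
    lin_fsum id (fun u => (x ++ u ++ y == w)%:R : R^o) r.
  rewrite /lin_fsum big_mkcond; apply: eq_bigr => t _.
  by case: eqP => _; rewrite /GRing.scale /= ?mulr1 ?mulr0.
rewrite !h.
by apply: (@lin_fsum_eq R (fun=> True) R id I (fun _ _ _ _ => I) (fun _ _ _ _ => erefl) R^o).
Qed.

Lemma idl_eq p q : fsum_eq p q -> idl p -> idl q.
Proof. by move=> pq [r [h e]]; exists r; split=> // w; rewrite -pq. Qed.

Lemma idl_cat p q : idl p -> idl q -> idl (p ++ q).
Proof.
move=> [r1 [h1 e1]] [r2 [h2 e2]]; exists (r1 ++ r2); split.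
  by move=> x; rewrite mem_cat => /orP[/h1|/h2].
by move=> w; rewrite map_cat flatten_cat !coef_cat e1 e2.
Qed.

Lemma idl_scale c p : S c -> idl p -> idl (fscale c p).
Proof.
move=> Sc [r [h e]]; exists [seq (c * x.1.1.1, x.1.1.2, x.1.2, x.2) | x <- r]; split.
  by move=> x /mapP[y /h[Sy yr] ->] /=; split=> //; apply: SM.
move=> w; rewrite coef_scale e -map_comp.
elim: r {h e} => [|x r IH] /=; first by rewrite /coef big_nil mulr0.
by rewrite !coef_cat mulrDr IH !coef_scale mulrA.
Qed.

Lemma idl_ctx x y p : idl p -> idl [seq (t.1, x ++ t.2 ++ y) | t <- p].
Proof.
move=> [r [h e]]; exists [seq (u.1.1.1, x ++ u.1.1.2, u.1.2, u.2 ++ y) | u <- r]; split.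
  by move=> u /mapP[v /h[Sv vr] ->].
move=> w; rewrite (coef_ctx x y e w) -map_comp map_flatten -map_comp; congr (coef (flatten _) w).
apply: eq_map => u /=; rewrite !fmul_ctx /fscale -!map_comp; apply: eq_map => t /=.
by rewrite -!catA.
Qed.

Lemma idl_rel r : r \in rels -> idl r.
Proof.
move=> rr; exists [:: (1, [::], r, [::])]; split.
  by move=> x; rewrite inE => /eqP->.
move=> w; rewrite /= cats0 fmul_ctx coef_scale mul1r /=; congr coef.
by rewrite -[LHS]map_id; apply: eq_map => -[c u] /=; rewrite cats0.
Qed.

Lemma idl_nil : idl [::].
Proof. by exists [::]. Qed.
End Ideal.

Section Span.
Variables (R : comNzRingType) (S : R -> Prop).
Hypotheses (S1 : S 1) (SN1 : S (-1)) (SM : forall x y, S x -> S y -> S (x * y)).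
Variables (rels : seq (fsum R)) (bs : seq word).
Notation idl := (in_ideal S rels).

Definition inU (p : fsum R) := exists q : fsum R,
  [/\ coefs_in S q, {subset [seq t.2 | t <- q] <= bs} & idl (fsub p q)].
Definition wordU (w : word) := inU (fword R w).
Definition weq (u v : word) := idl (fsub (fword R u) (fword R v)).

Lemma inU_eq p p' : idl (fsub p p') -> inU p' -> inU p.
Proof.
move=> h [q [Sq qb e]]; exists q; split=> //.
apply: idl_eq (idl_cat h e) => w.
by rewrite !(coef_cat, coef_scale); ring.
Qed.

Lemma inU_cat p q : inU p -> inU q -> inU (p ++ q).
Proof.
move=> [p' [Sp pb ep]] [q' [Sq qb eq]]; exists (p' ++ q'); split.
- by apply: coefs_in_cat.
- by move=> w; rewrite map_cat mem_cat => /orP[/pb|/qb].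
by apply: idl_eq (idl_cat ep eq) => w; rewrite !(coef_cat, coef_scale); ring.
Qed.

Lemma inU_scale c p : S c -> inU p -> inU (fscale c p).
Proof.
move=> Sc [q [Sq qb e]]; exists (fscale c q); split.
- by apply: coefs_in_scale.
- by move=> w; rewrite -map_comp => wq; apply: qb.
by apply: idl_eq (idl_scale SM Sc e) => w; rewrite !(coef_cat, coef_scale); ring.
Qed.

Lemma inU_lin (p : fsum R) : coefs_in S p -> (forall t, t \in p -> wordU t.2) -> inU p.
Proof.
elim: p => [|t p IH] Sp Up.
  by exists [::]; split=> //; apply: idl_nil.
apply: (@inU_eq _ (fscale t.1 (fword R t.2) ++ p)).
  apply: idl_eq (idl_nil _ _) => w.
  by rewrite !(coef_cat, coef_scale, coef_word, coef_cons) /coef big_nil; ring.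
apply: inU_cat.
  by apply: inU_scale; [apply: Sp; rewrite mem_head | apply: Up; rewrite mem_head].
by apply: IH => u up; [apply: Sp|apply: Up]; rewrite inE up orbT.
Qed.

Lemma wordU_bs w : w \in bs -> wordU w.
Proof.
move=> wb; exists (fword R w); split; first by apply: coefs_in_word.
  by move=> u; rewrite inE => /eqP->.
by apply: idl_eq (idl_nil _ _) => u; rewrite coef_sub subrr /coef big_nil.
Qed.

Lemma weq_refl u : weq u u.
Proof. by apply: idl_eq (idl_nil _ _) => w; rewrite coef_sub subrr /coef big_nil. Qed.

Lemma weq_sym u v : weq u v -> weq v u.
Proof.
move=> h; apply: idl_eq (idl_scale SM SN1 h) => w.
by rewrite coef_scale !coef_sub; ring.
Qed.

Lemma weq_trans v u w : weq u v -> weq v w -> weq u w.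
Proof.
move=> h1 h2; apply: idl_eq (idl_cat h1 h2) => x.
by rewrite coef_cat !coef_sub; ring.
Qed.

Lemma weq_ctx x y u v : weq u v -> weq (x ++ u ++ y) (x ++ v ++ y).
Proof. by move=> h; have := idl_ctx x y h. Qed.

Lemma wordU_weq u v : weq u v -> wordU v -> wordU u.
Proof. exact: inU_eq. Qed.

Lemma inU_ctx x y p : inU p ->
  (forall w, w \in bs -> wordU (x ++ w ++ y)) -> inU [seq (t.1, x ++ t.2 ++ y) | t <- p].
Proof.
move=> [q [Sq qb e]] h.
apply: (@inU_eq _ [seq (t.1, x ++ t.2 ++ y) | t <- q]).
  have := idl_ctx x y e; rewrite map_cat.
  by rewrite [X in idl (_ ++ X)](_ : _ = fscale (-1) [seq (t.1, x ++ t.2 ++ y) | t <- q]) // /fscale -!map_comp.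
apply: inU_lin; first by move=> t /mapP[u uq ->]; apply: (Sq u).
by move=> t /mapP[u uq ->] /=; apply: h; apply: qb; apply: map_f.
Qed.

Lemma wordU_ctx x y w : wordU w ->
  (forall w, w \in bs -> wordU (x ++ w ++ y)) -> wordU (x ++ w ++ y).
Proof. by move=> h hb; have := inU_ctx h hb. Qed.

End Span.

Section HeckeSpan.
Variable k' : nat.
Notation k := k'.+1.
Notation F := (FracR k).
Notation S := (@inRk k).
Notation idl := (in_ideal S (Hk_rels k)).
Notation a0 := (@param k ord0).
Variable bs : seq word.
Notation inU := (inU S (Hk_rels k) bs).
Notation wordU := (wordU S (Hk_rels k) bs).
Notation weq := (weq S (Hk_rels k)).

Let S1 := @inRk1 k'. Let SM := @inRkM k'. Let SN1 := @inRkN1 k'.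

Lemma Hk_rels_mem i : (i < 7)%N -> nth [::] (Hk_rels k) i \in Hk_rels k.
Proof. exact: (@mem_nth _ [::] (Hk_rels k)). Qed.

Lemma hecke_ctx l x y : l \in [:: l1; l2] ->
  idl (fsub (fword F (x ++ nseq k l ++ y)) [seq (param j, x ++ nseq j l ++ y) | j <- enum 'I_k]).
Proof.
move=> ll; have : idl (hecke_rel k l).
  apply: idl_rel; first exact: S1.
  have /orP[/eqP->|/eqP->] : (l == l1) || (l == l2) by move: ll; rewrite !inE.
    exact: (@Hk_rels_mem 5 isT).
  exact: (@Hk_rels_mem 6 isT).
move=> /(idl_ctx x y); rewrite /hecke_rel map_cat /fscale -!map_comp.
by rewrite /fsub /fscale -!map_comp.
Qed.

Lemma hecke_top l x y : l \in [:: l1; l2] ->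
  (forall j, (j < k)%N -> wordU (x ++ nseq j l ++ y)) -> wordU (x ++ nseq k l ++ y).
Proof.
move=> ll h; apply: (inU_eq (hecke_ctx x y ll)); apply: (inU_lin SM).
  by move=> t /mapP[j _ ->]; apply: inRk_param.
by move=> t /mapP[j _ ->]; apply: h.
Qed.

Lemma solve_bottom (K : fieldType) (c A B C : K) : c != 0 ->
  - c^-1 * (A - (c * B + C)) = B - c^-1 * (A - C).
Proof. by move=> cn; field. Qed.

(** Multiplying the Hecke relation by -a_0^-1 isolates the word with exponent 0; here a_0 must be a
    unit of R_k. *)
Lemma hecke_bot l x y : l \in [:: l1; l2] ->
  (forall j, (0 < j <= k)%N -> wordU (x ++ nseq j l ++ y)) -> wordU (x ++ y).
Proof.
move=> ll h.
pose rest : fsum F := [seq (param (lift ord0 j), x ++ nseq j.+1 l ++ y) | j <- enum 'I_k'].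
have Ea : S (- a0^-1) by rewrite -mulN1r; apply: SM; [exact: inRkN1 | exact: inRk_paramV].
have := idl_scale SM Ea (hecke_ctx x y ll).
rewrite enum_ordSl [map _ _]/= => h1.
apply: (@inU_eq _ _ _ _ _ (fscale a0^-1 (fsub (fword F (x ++ nseq k l ++ y)) rest))).
  apply: idl_eq h1 => w.
  rewrite [LHS]coef_scale [RHS]coef_sub !coef_word [coef (fscale _ _) w]coef_scale.
  rewrite [coef (fsub _ (_ :: _)) w]coef_sub [coef (fsub _ rest) w]coef_sub !coef_word.
  rewrite [coef (_ :: _) w]coef_cons [_.1]/= [_.2]/=.
  have -> : coef [seq (param j, x ++ nseq j l ++ y) | j <- [seq lift ord0 i | i <- enum 'I_k']] w
     = coef rest w.
    by rewrite /rest -map_comp; congr coef; apply: eq_map => j /=; rewrite /bump.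
  exact: solve_bottom (param_neq0 _).
apply: (inU_scale SM); first exact: inRk_paramV.
apply: inU_cat; first by apply: h; rewrite ltnSn.
apply: (inU_scale SM); first exact: inRkN1.
apply: (inU_lin SM) => t /mapP[j _ ->]; first exact: inRk_param.
by apply: (h j.+1); rewrite ltnS /= ltnS ltnW.
Qed.

Definition lw (s : bool * bool) : 'I_4 :=
  if s.1 then (if s.2 then l2i else l2) else (if s.2 then l1i else l1).

Lemma lw_cancel g v : weq [:: lw (g, v); lw (g, ~~ v)] [::].
Proof.
case: g v => [] []; apply: idl_rel; try exact: S1.
- exact: (@Hk_rels_mem 3 isT).
- exact: (@Hk_rels_mem 2 isT).
- exact: (@Hk_rels_mem 1 isT).
- exact: (@Hk_rels_mem 0 isT).
Qed.

Lemma lw_braid : weq [:: lw (false, false); lw (true, false); lw (false, false)]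
  [:: lw (true, false); lw (false, false); lw (true, false)].
Proof. by apply: idl_rel; [exact: S1 | exact: (@Hk_rels_mem 4 isT)]. Qed.

(** The word l^-1 w is the bottom of the line l^-1 l^j w, and for j > 0 these elements equal l^(j-1)
    w. *)
Lemma wordU_inv_left l li : l \in [:: l1; l2] -> weq [:: li; l] [::] ->
  (forall w, wordU w -> wordU (l :: w)) -> forall w, wordU w -> wordU (li :: w).
Proof.
move=> ll lil h w Uw; apply: (hecke_bot (x := [:: li]) ll) => -[//|j] _.
apply: (@wordU_weq _ _ _ _ _ (nseq j l ++ w)).
  by have := weq_ctx [::] (nseq j l ++ w) lil.
by elim: j => //= j IH; apply: h.
Qed.

Lemma wordU_inv_right l li : l \in [:: l1; l2] -> weq [:: l; li] [::] ->
  (forall w, wordU w -> wordU (w ++ [:: l])) -> forall w, wordU w -> wordU (w ++ [:: li]).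
Proof.
move=> ll lil h w Uw; apply: (hecke_bot (y := [:: li]) ll) => -[//|j] _.
apply: (@wordU_weq _ _ _ _ _ (w ++ nseq j l)).
  have := weq_ctx (w ++ nseq j l) [::] lil; rewrite !cats0 -catA -cat1s !catA.
  by rewrite -(addn1 j) nseqD !catA.
elim: j => [|j IH]; first by rewrite cats0.
by rewrite -(addn1 j) nseqD catA; apply: h.
Qed.
End HeckeSpan.

Notation towl := (tow lw).

(** * Bimodule generators and certificates of closure *)

Definition core (c : int * sword) : word := towl (dpow (c.1 + c.1) ++ c.2).
(* The bimodule generated by a power of the central element needs no right powers of a. *)
Definition right_range (k : nat) (c : int * sword) : nat := if c.2 is [::] then 1%N else k.
Definition basis_words (k : nat) (gens : seq (int * sword)) : seq word :=
  flatten [seq [seq nseq i l1 ++ core c ++ nseq j l1 | i <- iota 0 k, j <- iota 0 (right_range k c)]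
          | c <- gens].

(** Nested conditionals stop at the first difference under call-by-value evaluation, where [&&]
    would evaluate both of its arguments. *)
Fixpoint eq_bits (u v : seq bool) : bool :=
  match u, v with
  | [::], [::] => true
  | x :: u', y :: v' => if x then (if y then eq_bits u' v' else false)
                        else (if y then false else eq_bits u' v')
  | _, _ => false
  end.
Definition eq_garside (m n : garside) : bool :=
  match m.1, n.1 with
  | Posz a, Posz b => if eqn a b then eq_bits m.2 n.2 else false
  | Negz a, Negz b => if eqn a b then eq_bits m.2 n.2 else false
  | _, _ => false
  end.

Lemma eq_garsideP m n : eq_garside m n -> m = n.
Proof.
have eq_bitsP : forall u v, eq_bits u v -> u = v.
  by elim=> [|x u IH] [|y v] //=; case: x; case: y => // /IH ->.
by case: m n => [[a|a] u] [[b|b] v]; rewrite /eq_garside //=; case: eqnP => // -> /eq_bitsP ->.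
Qed.

Definition known (kn : seq garside) (n : garside) : bool := has (eq_garside n) kn.

(* A step (m, x, y, top) adds one end of the line z^m x a^n y, 0 <= n <= k, *)
(* once the k other elements of the line are known. *)
Definition step := (int * sword * sword * bool)%type.
Definition line_key (st : step) (n : nat) : garside :=
  gkey st.1.1.1 (st.1.1.2 ++ nseq n (false, false) ++ st.1.2).
(** A step whose premises are not yet known changes nothing. Soundness therefore holds for every
    list of steps, and only the final test depends on the list. *)
Definition run_step (k : nat) (kn : seq garside) (st : step) : seq garside :=
  if st.2 then (if all (fun n => known kn (line_key st n)) (iota 0 k) then line_key st k :: kn else kn)
  else (if all (fun n => known kn (line_key st n)) (iota 1 k) then line_key st 0 :: kn else kn).

(** It suffices to test b a^n z^m g: further powers of a on the right preserve U, and z is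
    central. *)
Definition closed_under_b (k : nat) (gens : seq (int * sword)) (steps : seq step) : bool :=
  let kn := foldl (run_step k) [seq gkey c.1 c.2 | c <- gens] steps in
  all (fun c => all (fun n => known kn (gkey c.1 ((true, false) :: nseq n (false, false) ++ c.2)))
                    (iota 0 k)) gens.

Section Closure.
Variables (k' : nat) (gens : seq (int * sword)) (steps : seq step).
Notation k := k'.+1.
Notation S := (@inRk k).
Let bs := basis_words k gens.
Notation wordU := (wordU S (Hk_rels k) bs).
Notation weq := (weq S (Hk_rels k)).
Let S1 := @inRk1 k'. Let SM := @inRkM k'. Let SN1 := @inRkN1 k'.

Let wrefl u : weq u u. Proof. exact: weq_refl. Qed.
Let wsym u v : weq u v -> weq v u. Proof. exact: weq_sym. Qed.
Let wtrans v u w : weq u v -> weq v w -> weq u w. Proof. exact: weq_trans. Qed.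
Let wctx x y u v : weq u v -> weq (x ++ u ++ y) (x ++ v ++ y). Proof. exact: weq_ctx. Qed.
Let wcancel := @lw_cancel k'.
Let wbraid := @lw_braid k'.

Lemma basis_wordsP w : w \in bs -> exists c i j,
  [/\ c \in gens, (i < k)%N, (j < right_range k c)%N & w = nseq i l1 ++ core c ++ nseq j l1].
Proof.
move=> /flattenP[s /mapP[c cg ->]] /allpairsP[[i j] [ik jk ->]].
move: ik jk; rewrite !mem_iota !add0n => /andP[_ ik] /andP[_ jk].
by exists c, i, j.
Qed.

Lemma mem_basis_words c i j : c \in gens -> (i < k)%N -> (j < right_range k c)%N ->
  nseq i l1 ++ core c ++ nseq j l1 \in bs.
Proof.
move=> cg ik jk; apply/flattenP; eexists; first exact: (map_f _ cg).
by apply/allpairsP; exists (i, j); rewrite !mem_iota !add0n.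
Qed.

Let l1in : l1 \in [:: l1; l2]. Proof. by rewrite inE eqxx. Qed.
Let l2in : l2 \in [:: l1; l2]. Proof. by rewrite !inE eqxx orbT. Qed.

Lemma wordU_l1 w : wordU w -> wordU (l1 :: w).
Proof.
move=> Uw; have := @wordU_ctx _ _ SM _ bs [:: l1] [::] w Uw; rewrite cats0; apply=> b.
move=> /basis_wordsP[c [i [j [cg ik jk ->]]]]; rewrite cats0.
have [ik'|] := ltnP i.+1 k.
  by apply: wordU_bs => //; apply: (@mem_basis_words c i.+1).
move=> ki; have -> : i = k' by apply/eqP; rewrite eqn_leq -ltnS ik.
apply: (hecke_top (x := [::]) l1in) => n nk.
by apply: wordU_bs => //; apply: mem_basis_words.
Qed.

Lemma wordU_l1i w : wordU w -> wordU (l1i :: w).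
Proof. exact: (wordU_inv_left l1in (wcancel false true) wordU_l1). Qed.

Lemma wordU_l1_nseq n w : wordU w -> wordU (nseq n l1 ++ w).
Proof. by move=> Uw; elim: n => //= n IH; apply: wordU_l1. Qed.

(** For a generator z^m the new letter a passes through the central factor to the left. For the
    others, the right exponent either stays below k or reaches k and is reduced by [hecke_top]. *)
Lemma wordU_rl1 w : wordU w -> wordU (w ++ [:: l1]).
Proof.
move=> Uw; have := @wordU_ctx _ _ SM _ bs [::] [:: l1] w Uw; apply=> b.
move=> /basis_wordsP[c [i [j [cg ik jk ->]]]] /=.
have [jk'|kj] := ltnP j.+1 (right_range k c).
  rewrite -!catA; have -> : nseq j l1 ++ [:: l1] = nseq j.+1 l1 by rewrite -(addn1 j) nseqD.
  by apply: wordU_bs => //; apply: mem_basis_words.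
have js : j.+1 = right_range k c by apply/eqP; rewrite eqn_leq jk.
case: c => m g in cg jk kj js *; case: g => [|x g] in cg jk kj js *.
  case: js => ->; rewrite cats0.
  apply: (@wordU_weq _ _ _ _ _ (nseq i l1 ++ ([:: l1] ++ core (m, [::])))).
    rewrite -catA -[X in weq X _]cats0 -[X in weq _ X]cats0 -!catA [_ ++ _ ++ [::]]catA.
    rewrite [X in weq _ (_ ++ X)]catA; apply: wctx.
    rewrite /core /= cats0.
    exact: (dpow_even_central wrefl wsym wtrans wctx wcancel wbraid m [:: (false, false)]).
  apply: wordU_l1_nseq; apply: wordU_l1; apply: wordU_bs => //.
  by have := @mem_basis_words (m, [::]) 0 0 cg isT isT; rewrite cats0.
case: js => ->; rewrite -!catA.
have -> : nseq k' l1 ++ [:: l1] = nseq k l1 ++ [::] by rewrite cats0 -(addn1 k') nseqD.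
rewrite catA; apply: (hecke_top l1in) => n nk; rewrite cats0 -catA.
by apply: wordU_bs => //; apply: mem_basis_words.
Qed.

Lemma wordU_rl1i w : wordU w -> wordU (w ++ [:: l1i]).
Proof. exact: (wordU_inv_right l1in (wcancel false false) wordU_rl1). Qed.

Lemma wordU_apow i j w : wordU w -> wordU (towl (apow i) ++ w ++ towl (apow j)).
Proof.
move=> Uw; have lU n v u : wordU u -> wordU (towl (nseq n (false, v)) ++ u).
  move=> Uu; elim: n => //= n IH; rewrite {1}/lw /=.
  by case: v IH => IH; [apply: wordU_l1i | apply: wordU_l1].
have rU n v u : wordU u -> wordU (u ++ towl (nseq n (false, v))).
  move=> Uu; elim: n => [|n IH]; first by rewrite cats0.
  rewrite -(addn1 n) nseqD tow_cat catA /= {2}/lw /=.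
  by case: v IH => IH; [apply: wordU_rl1i | apply: wordU_rl1].
by apply: lU; apply: rU.
Qed.

(** U is stable under a and a^-1 on both sides, so membership depends only on the double coset of
    the powers of a that the key records. *)
Lemma wordU_gkey m s : wordU (gword lw (gkey m s)) <-> wordU (towl (dpow (m + m) ++ s)).
Proof.
have := gkey_sound wrefl wsym wtrans wctx wcancel wbraid m s.
case: (strip s) => i j; rewrite tow_cat => h; split => [Uk|Uw].
  by apply: (wordU_weq h); apply: wordU_apow.
have := wordU_apow (Z.opp i) (Z.opp j) Uw; apply: wordU_weq.
have c i' u v : weq (u ++ (towl (apow i') ++ towl (apow (Z.opp i'))) ++ v) (u ++ v).
  by have := wctx u v (apow_cancel wrefl wtrans wctx wcancel i').
apply: wsym; apply: (wtrans (wctx _ _ h)); rewrite -!catA.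
set K := gword _ _.
apply: (@wtrans (towl (apow (Z.opp i)) ++ towl (apow i) ++ K)).
  rewrite !catA; have := c j ((towl (apow (Z.opp i)) ++ towl (apow i)) ++ K) [::].
  by rewrite !cats0 !catA.
have := c (Z.opp i) [::] K; by rewrite Z.opp_involutive /= -!catA.
Qed.

Lemma known_mem kn n : known kn n -> n \in kn.
Proof. by case/hasP => x xk /eq_garsideP ->. Qed.

Definition sound (kn : seq garside) := forall n, n \in kn -> wordU (gword lw n).

Lemma run_step_sound kn st : sound kn -> sound (run_step k kn st).
Proof.
move=> skn; case: st => [[[m x] y] top]; rewrite /run_step -[_.2]/top.
have lineU n : wordU (gword lw (line_key (m, x, y, top) n)) <->
    wordU ((towl (dpow (m + m) ++ x)) ++ nseq n l1 ++ towl y).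
  rewrite /line_key wordU_gkey /= catA !tow_cat.
  have -> : towl (nseq n (false, false)) = nseq n l1 by rewrite /tow map_nseq.
  by [].
have allU a b : all (fun n => known kn (line_key (m, x, y, top) n)) (iota a b) ->
    forall n, (a <= n < a + b)%N -> wordU ((towl (dpow (m + m) ++ x)) ++ nseq n l1 ++ towl y).
  move=> /allP h n nab; apply/lineU/skn/known_mem/h; by rewrite mem_iota.
case: top lineU allU => lineU allU; case: ifP => // /allU h n; rewrite inE => /orP[/eqP->|/skn//].
  by apply/lineU; apply: (hecke_top l1in) => j jk; apply: h.
by apply/lineU; apply: (hecke_bot l1in) => j jk; apply: h.
Qed.

Hypothesis closed_b : closed_under_b k gens steps.
Variable m0 : int.
Hypothesis m0_gens : (m0, [::]) \in gens.

Lemma wordU_core c : c \in gens -> wordU (core c).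
Proof.
move=> cg; apply: wordU_bs => //.
have := @mem_basis_words c 0 0 cg isT; rewrite cats0; apply.
by rewrite /right_range; case: (c.2).
Qed.

Lemma wordU_l2_core c n : c \in gens -> (n < k)%N ->
  wordU (towl (dpow (c.1 + c.1) ++ (true, false) :: nseq n (false, false) ++ c.2)).
Proof.
move=> cg nk; move: closed_b; rewrite /closed_under_b; set kn := foldl _ _ _ => hall.
have skn : sound kn.
  rewrite /kn; elim/last_ind: (steps) => [|st s IH].
    by move=> x /mapP[d dg ->]; apply/wordU_gkey; apply: wordU_core.
  by rewrite foldl_rcons; apply: run_step_sound.
apply/wordU_gkey/skn/known_mem.
by move/allP/(_ c cg)/allP/(_ n): hall; apply; rewrite mem_iota.
Qed.

Lemma wordU_l2 w : wordU w -> wordU (l2 :: w).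
Proof.
move=> Uw; have := @wordU_ctx _ _ SM _ bs [:: l2] [::] w Uw; rewrite cats0; apply=> b.
move=> /basis_wordsP[c [i [j [cg ik jk ->]]]]; rewrite cats0.
have := wordU_apow Z0 (Z.of_nat j) (wordU_l2_core cg ik).
have -> : towl (apow (Z.of_nat j)) = nseq j l1.
  by rewrite /apow Zabs2Nat.id /tow map_nseq; case: (j).
apply: wordU_weq; rewrite cat0s.
have -> : [:: l2] ++ nseq i l1 ++ core c ++ nseq j l1 =
  ([:: l2] ++ nseq i l1 ++ core c) ++ nseq j l1 by rewrite -!catA.
apply: (eqv_catr wrefl wtrans wctx); rewrite /core -cat_cons !tow_cat.
have sE : [:: l2] ++ nseq i l1 = towl ((true, false) :: nseq i (false, false)).
  by rewrite /tow /= map_nseq.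
rewrite catA sE !catA; apply: (eqv_catr wrefl wtrans wctx); apply: wsym.
exact: (dpow_even_central wrefl wsym wtrans wctx wcancel wbraid).
Qed.

Lemma wordU_l2i w : wordU w -> wordU (l2i :: w).
Proof. exact: (wordU_inv_left l2in (wcancel true true) wordU_l2). Qed.

(** U is stable under left multiplication by all four letters and contains the invertible element
    z^m0. Multiplying first by an inverse v of z^m0 and then by w reaches w. *)
Lemma wordU_all w : wordU w.
Proof.
have left v u : wordU u -> wordU (v ++ u).
  move=> Uu; elim: v => //= l v IH.
  have : l \in [:: l1; l2; l1i; l2i].
    rewrite -(inord_val l) !inE; case: l => [[|[|[|[|]]]]] //= _.
    - by rewrite -/l1 eqxx.
    - by rewrite -/l2 eqxx orbT.
    - by rewrite -/l1i eqxx !orbT.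
    - by rewrite -/l2i eqxx !orbT.
  rewrite !inE => /orP[/eqP->|/orP[/eqP->|/orP[/eqP->|/eqP->]]].
  - exact: wordU_l1. - exact: wordU_l2. - exact: wordU_l1i. - exact: wordU_l2i.
have [v hv] : exists v, weq (v ++ core (m0, [::])) [::].
  rewrite /core /= cats0; elim: (dpow _) => [|[g v] s [u hu]]; first by exists [::]; apply: wrefl.
  exists (u ++ [:: lw (g, ~~ v)]); apply: wtrans hu; rewrite -catA /=.
  by have := wctx u (towl s) (wcancel g (~~ v)); rewrite negbK.
apply: (@wordU_weq _ _ _ _ _ (w ++ v ++ core (m0, [::]))).
  by apply: wsym; have := wctx w [::] hv; rewrite !cats0.
by rewrite catA; apply: left; apply: wordU_core.
Qed.

Theorem basis_words_span p : coefs_in S p -> inU S (Hk_rels k) bs p.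
Proof. by move=> Sp; apply: (inU_lin SM) => // t _; apply: wordU_all. Qed.
End Closure.

Local Close Scope ring_scope.

(* Exponents of b, a, b, a, ... *)
Fixpoint syllables (g : bool) (es : seq int) : sword :=
  if es is e :: es' then
    match e with Posz n => nseq n (g, false) | Negz n => nseq n.+1 (g, true) end
      ++ syllables (~~ g) es'
  else [::].

Definition mk_step (s : int * seq int * seq int * bool) : step :=
  (s.1.1.1, syllables true s.1.1.2, syllables true s.1.2, s.2).

Definition levels (m : int) (n : nat) (es : seq int) : seq (int * sword) :=
  [seq (m + Posz i, syllables true es)%R | i <- iota 0 n].

(** The bimodules u z^m have k words and the others k^2. The totals are 2 + 4 = 6, 2*3 + 2*9 = 24,
    4*4 + 4*16 + 16 = 96 and 10*5 + 10*25 + 10*25 + 2*25 = 600. *)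
Definition gens2 : seq (int * sword) := levels 0 1 [::] ++ levels 0 1 [:: 1%Z].
Definition gens3 : seq (int * sword) := levels 0 2 [::] ++ levels (-1)%Z 2 [:: 1%Z].
Definition gens4 : seq (int * sword) :=
  levels 0 4 [::] ++ levels (-1)%Z 4 [:: 1%Z] ++ levels 0 1 [:: 2%Z].
Definition gens5 : seq (int * sword) :=
  levels 1%Z 10 [::] ++ levels 0 10 [:: 1%Z] ++ levels 0 10 [:: 2%Z] ++ levels 3%Z 2 [:: 2; -1; 1]%Z.

(** The order of the steps matters, as each uses the keys obtained before it. For k = 2 the single
    line is b a^n b^-1: its members for n = 0, 1 are 1 and a^-1 b a, so the next one, a^-1 b^2 a,
    brings in b^2. *)
Definition steps2 : seq step := map mk_step
  ([:: (0, [:: 1], [:: -1], true)])%Z.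

Definition steps3 : seq step := map mk_step
  ([:: (0, [:: -1; -1], [:: 1], true);
   (1, [:: -1; -4], [:: -1], false);
   (2, [:: -1; -4], [:: -1], true)])%Z.

Definition steps4 : seq step := map mk_step
  ([:: (1, [:: -1; -4], [:: -1], false);
   (0, [:: -1; -1], [:: 1], true);
   (2, [:: -1; -4], [:: -1], true);
   (1, [:: -1; -1], [:: 1], true);
   (3, [:: -1; -5], [:: -1], false);
   (3, [:: -1; -4], [:: -1], true);
   (1, [:: 2; -2], [:: -1], true);
   (3, [:: -1; -4], [:: -2], true);
   (4, [:: -1; -5], [:: -1], true)])%Z.

Definition steps5 : seq step := map mk_step
  ([:: (2, [:: -1; -4], [:: -1], true);
   (3, [:: -1; -4], [:: -1], true);
   (3, [:: -1; -5], [:: -1], false);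
   (4, [:: -1; -4], [:: -1], true);
   (4, [:: -1; -5], [:: -1], false);
   (5, [:: -1; -4], [:: -1], true);
   (5, [:: -1; -5], [:: -1], false);
   (6, [:: -1; -4], [:: -1], true);
   (6, [:: -1; -5], [:: -1], false);
   (7, [:: -1; -4], [:: -1], true);
   (7, [:: -1; -5], [:: -1], false);
   (8, [:: -1; -4], [:: -1], true);
   (8, [:: -1; -5], [:: -1], false);
   (9, [:: -1; -4], [:: -1], true);
   (9, [:: -1; -5], [:: -1], false);
   (10, [:: -1; -4], [:: -1], true);
   (10, [:: -1; -5], [:: -1], false);
   (1, [:: -1; -1], [:: 1], true);
   (2, [:: -1; -1], [:: 1], true);
   (4, [:: -1; -3], [:: -2], true);
   (3, [:: -1; -1], [:: 2], true);
   (3, [:: -1; -1], [:: 1], true);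
   (4, [:: -1; -4], [:: -2], false);
   (3, [:: -2; -4], [:: -1], false);
   (4, [:: -1; -6], [:: -1], false);
   (2, [:: 2; -2], [:: -1], true);
   (2, [:: 1], [:: -1], true);
   (4, [:: 3; -3], [:: -1], true);
   (5, [:: -1; -3], [:: -2], true);
   (4, [:: -1; -1], [:: 2], true);
   (4, [:: -1; -1], [:: 1], true);
   (5, [:: -1; -4], [:: -2], false);
   (5, [:: -1; -5], [:: -2], false);
   (5, [:: -2; -4], [:: -1], true);
   (4, [:: -2; -4], [:: -1], false);
   (4, [:: 2; -4], [:: -1], false);
   (5, [:: -1; -6], [:: -1], false);
   (4, [:: -3; -4], [:: -1], false);
   (4, [:: 2; -2], [:: -1], true);
   (6, [:: -1; -4], [:: -1; -3; -2], true);
   (4, [:: 3; -2], [:: -1], true);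
   (3, [:: 1], [:: -1], true);
   (5, [:: -1; -1], [:: 1], true);
   (6, [:: -1; -4], [:: -2], true);
   (6, [:: -1; -5], [:: -2], false);
   (6, [:: -2; -4], [:: -1], true);
   (5, [:: 2; -4], [:: -1], false);
   (6, [:: -1; -6], [:: -1], false);
   (5, [:: -3; -3], [:: -1], true);
   (7, [:: -1; -5], [:: -1; -3; -2], true);
   (5, [:: -3; -4], [:: -1], false);
   (5, [:: 2; -2], [:: -1], true);
   (5, [:: 3; -2], [:: -1], true);
   (4, [:: 1], [:: -1], true);
   (4, [:: -3], [:: 1], true);
   (5, [:: 3; -4], [:: -1], false);
   (6, [:: -1; -3], [:: -2], true);
   (5, [:: 2; -1], [:: -1], true);
   (6, [:: -1; -1], [:: 1], true);
   (7, [:: -1; -4], [:: -2], true);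
   (7, [:: -1; -5], [:: -2], false);
   (7, [:: -2; -4], [:: -1], true);
   (6, [:: 2; -4], [:: -1], false);
   (7, [:: -1; -6], [:: -2], false);
   (7, [:: -1; -6], [:: -1], false);
   (8, [:: -1; -5], [:: -1; -3; -2], true);
   (6, [:: -3; -4], [:: -1], false);
   (6, [:: 2; -2], [:: -1], true);
   (7, [:: -1; -7], [:: -1], false);
   (8, [:: -1; -4], [:: -1; -3; -2], true);
   (6, [:: 3; -2], [:: -1], true);
   (6, [:: -4; -4], [:: -1], false);
   (5, [:: 1], [:: -1], true);
   (7, [:: -1; -3], [:: -2], true);
   (6, [:: 2; -1], [:: -1], true);
   (6, [:: 2], [:: -1], true);
   (7, [:: -1; -1], [:: 1], true);
   (8, [:: -1; -4], [:: -2], true);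
   (8, [:: -1; -5], [:: -2], false);
   (8, [:: -2; -4], [:: -1], true);
   (7, [:: 2; -4], [:: -1], false);
   (8, [:: -1; -6], [:: -2], false);
   (8, [:: -2; -6], [:: -1], false);
   (8, [:: -1; -6], [:: -1], false);
   (7, [:: -3; -3], [:: -1], true);
   (9, [:: -1; -5], [:: -1; -3; -2], true);
   (7, [:: -3; -4], [:: -1], false);
   (7, [:: 2; -2], [:: -1], true);
   (8, [:: -1; -7], [:: -2], false);
   (8, [:: -1; -7], [:: -1], false);
   (7, [:: -1; -4], [:: -4], false);
   (7, [:: -4; -3], [:: -1], true);
   (7, [:: 3; -2], [:: -1], true);
   (6, [:: 1], [:: -1], true);
   (8, [:: -1; -3], [:: -2], true);
   (8, [:: -1; -1], [:: 1], true);
   (9, [:: -1; -4], [:: -2], true);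
   (9, [:: -1; -5], [:: -2], false);
   (9, [:: -2; -4], [:: -1], true);
   (8, [:: 2; -4], [:: -1], false);
   (9, [:: -1; -6], [:: -2], false);
   (9, [:: -2; -6], [:: -1], false);
   (9, [:: -1; -6], [:: -1], false);
   (10, [:: -1; -5], [:: -1; -3; -2], true);
   (8, [:: -3; -4], [:: -1], false);
   (9, [:: -1; -7], [:: -2], false);
   (9, [:: -1; -7], [:: -1], false);
   (10, [:: -1; -4], [:: -1; -3; -2], true);
   (8, [:: -1; -4], [:: -4], false);
   (8, [:: -4; -3], [:: -1], true);
   (8, [:: -4; -4], [:: -1], false);
   (7, [:: 1], [:: -1], true);
   (8, [:: 3; -4], [:: -1], false);
   (10, [:: -1; -6], [:: -1], false);
   (10, [:: -1; -7], [:: -1], false);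
   (8, [:: 1], [:: -1], true);
   (4, [:: 1], [:: -3], true);
   (5, [:: -1; -5], [:: -1; -3; -2], true);
   (5, [:: -1; -4], [:: -1; -3; -2], true);
   (3, [:: 3; -2], [:: -1], true);
   (4, [:: -1; 1], [:: 1], true);
   (5, [:: -1], [:: -1], true);
   (5, [:: -1; 1], [:: 1], true);
   (5, [:: 3; -1], [:: -1], true);
   (6, [:: -1; -1], [:: 3], true);
   (7, [:: 1], [:: -3], true);
   (7, [:: -1; 1], [:: 1], true);
   (8, [:: -1], [:: -1], true);
   (3, [:: 3; -3], [:: -1], false);
   (3, [:: 3; -1], [:: -1], true);
   (3, [:: 4; -3], [:: -1], false);
   (5, [:: -1; -3], [:: -1; 2; -1], true);
   (6, [:: -1; -3], [:: -1; 2; -1], true);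
   (8, [:: -1; -3], [:: -1; 2; -1], true);
   (7, [:: -1; -1], [:: 4], true);
   (5, [:: -2; -4], [:: -2], false);
   (4, [:: 2; -2], [:: -2], true);
   (5, [:: -2; -2], [:: -2], true);
   (6, [:: -2; -4], [:: -2], false);
   (5, [:: 2; -2], [:: -2], true);
   (4, [:: 4; -1], [:: -1], true);
   (6, [:: -1; -4], [:: -1; 1; -2], true);
   (6, [:: -1; -4], [:: -1; 2; -2], true);
   (6, [:: -1; -3; 2; -3], [:: -1], true);
   (6, [:: 2; -4], [:: -1; -3; -2], false);
   (7, [:: -2; -4], [:: -2], false);
   (6, [:: 2; -2], [:: -2], true);
   (6, [:: -1; -3], [:: -1; 2; -2], true);
   (5, [:: -1; 1; -2; -4], [:: -1], false);
   (4, [:: -1; 1; -2], [:: 1], true);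
   (5, [:: -1; -3], [:: -2; 2; -1], true);
   (7, [:: -1; 1; -2; -4], [:: -1], true);
   (4, [:: -1; -4], [:: -1; 1; -2], false);
   (7, [:: -3; -3], [:: -2], true);
   (7, [:: -1; -3; 2; -3], [:: -1], true);
   (7, [:: -3; -4], [:: -2], false);
   (7, [:: -1; -3; 2; -4], [:: -1], false);
   (8, [:: -2; -4], [:: -1; -3; -2], true);
   (7, [:: 2; -4], [:: -1; -3; -2], false);
   (3, [:: 1], [:: 2; 4; -1], true);
   (6, [:: 2; -2], [:: -3], true);
   (7, [:: -1; -4], [:: -1; 1; -2], true);
   (6, [:: -1; 1; 4; -2], [:: -1], true);
   (8, [:: -2; -4], [:: -2], true);
   (7, [:: 2; -4], [:: -2], false);
   (6, [:: -1; 2; 3; -4], [:: -1], false);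
   (7, [:: -1; -4], [:: -1; -4; -2], true);
   (7, [:: -1; -5], [:: -1; -4; -2], false);
   (6, [:: -1; -3], [:: -1; 2; -3], true);
   (6, [:: -1; 1; -2; -4], [:: -1], false);
   (5, [:: -1; 1; -2], [:: 1], true);
   (8, [:: -1; 1; -2; -4], [:: -1], true);
   (5, [:: -1; -4], [:: -1; 1; -2], false);
   (8, [:: -1; -3; 2; -5], [:: -1], false);
   (8, [:: -1; -3; 2; -3], [:: -1], true);
   (8, [:: 2; -4], [:: -1; -3; -2], false);
   (8, [:: -1; -4], [:: -1; 1; -2], true);
   (6, [:: -1; 3; 3; -4], [:: -1], true);
   (8, [:: 2; -4], [:: -2], false);
   (9, [:: -1; -5], [:: -3], false);
   (9, [:: -1; -4], [:: -3], true);
   (8, [:: -1; -4; 2; -3], [:: -1], true);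
   (7, [:: -2; -4], [:: -1; 2; -1], true);
   (9, [:: -2; -6], [:: -2], false);
   (9, [:: -1; 1; -2; -4], [:: -1], true);
   (7, [:: -1; -4; -3; -4], [:: -1], false);
   (9, [:: 2; -4], [:: -1], true);
   (9, [:: -4; -4], [:: -1], true);
   (10, [:: -1; -4], [:: -2], true);
   (9, [:: -3; -5], [:: -1; -3; -2], false);
   (9, [:: -1; -3; -4; -3], [:: -1], true);
   (9, [:: -1; -3; -4; -4], [:: -1], false);
   (6, [:: 1], [:: -1; 1; -2], true);
   (9, [:: -1; -5], [:: -1; -6; -2], false);
   (8, [:: -1; -3], [:: -3; 2; -1], true);
   (7, [:: 1], [:: -3; 2; -1], true);
   (6, [:: -2; -4], [:: -1; -3; -2], true);
   (5, [:: 2; -4], [:: -1; -3; -2], false);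
   (6, [:: 3; -4], [:: -1; -3; -2], true);
   (5, [:: 3; -3], [:: -1; 2; -1], true);
   (8, [:: -1; 3; -2; -4], [:: -1], true);
   (8, [:: -1; 3; -2; -3], [:: -1], true);
   (9, [:: 4; -5], [:: -1; -3; -2], true);
   (6, [:: 2; -2], [:: -2; 2; -1], true);
   (4, [:: -1; 1; -2; -3], [:: -1], false);
   (3, [:: -2; -2], [:: -2], true);
   (4, [:: -1; -4], [:: -1; 2; -2], true);
   (4, [:: 2; -2], [:: -1; 1; -2], true);
   (10, [:: -2; -4], [:: -1], true);
   (7, [:: -1; 1; -2; -4], [:: -2], false);
   (8, [:: -2; -4], [:: -1; -5; -2], true);
   (6, [:: -2; 2; -2; -4], [:: -1], true);
   (2, [:: 3; -3], [:: -1], false);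
   (7, [:: -2; 2; -3; -3], [:: -1], true);
   (2, [:: -1; -3], [:: -2], false);
   (9, [:: -1; -3; 2; -5], [:: -1; -3; -2], true);
   (10, [:: -1; -5], [:: -1; -5; -2], true);
   (10, [:: -1; -4], [:: -1; -5; -2], true);
   (9, [:: 2; -4], [:: -2], true);
   (9, [:: 3; -4], [:: -2], true);
   (11, [:: -1; -6], [:: -1], true);
   (10, [:: 2; -4], [:: -1], true);
   (11, [:: -1; -4], [:: -2], true);
   (11, [:: -1; -5], [:: -1], true)])%Z.

Lemma closed2 : closed_under_b 2 gens2 steps2.
Proof. by vm_compute. Qed.

Lemma closed3 : closed_under_b 3 gens3 steps3.
Proof. by vm_compute. Qed.

Lemma closed4 : closed_under_b 4 gens4 steps4.
Proof. by vm_compute. Qed.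

Lemma closed5 : closed_under_b 5 gens5 steps5.
Proof. by vm_compute. Qed.

Local Open Scope ring_scope.

(** * The finite quotients *)

(* The reflection representation of W_k modulo a prime p: a = [z 1; 0 1], b = [1 0; -z z], *)
(* where z is a primitive k-th root of unity modulo p. *)
Section ReflectionGroup.
Variables (k p z : nat).

Definition refl (g : bool) (v : nat * nat) : nat * nat :=
  if g then (v.1, ((p - z) * v.1 + z * v.2) %% p)%N else ((z * v.1 + v.2) %% p, v.2)%N.
Definition refl_letter (l : bool * bool) (v : nat * nat) : nat * nat :=
  if l.2 then iter k.-1 (refl l.1) v else refl l.1 v.
Definition refl_word (s : sword) (v : nat * nat) : nat * nat :=
  foldl (fun u l => refl_letter l u) v s.

(** The relations are tested on every vector modulo p, so that the two maps become permutations of a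
    finite set satisfying the relations of W_k. *)
Definition refl_check : bool :=
  all (fun x => all (fun y =>
    [&& iter k (refl false) (x, y) == (x, y), iter k (refl true) (x, y) == (x, y) &
        refl false (refl true (refl false (x, y))) == refl true (refl false (refl true (x, y)))])
    (iota 0 p)) (iota 0 p).

Hypotheses (p_gt1 : (1 < p)%N) (k_gt0 : (0 < k)%N) (checked : refl_check).
Let p_gt0 : (0 < p)%N := ltnW p_gt1.
Notation T := ('I_p * 'I_p)%type.
Let pv (t : T) : nat * nat := (val t.1, val t.2).

Let pv_inj : injective pv.
Proof. by move=> [x y] [x' y'] [] /val_inj -> /val_inj ->. Qed.

Definition reflT (g : bool) (t : T) : T :=
  if g then (t.1, Ordinal (ltn_pmod ((p - z) * t.1 + z * t.2) p_gt0))
  else (Ordinal (ltn_pmod (z * t.1 + t.2) p_gt0), t.2).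

Let pv_reflT g t : pv (reflT g t) = refl g (pv t).
Proof. by case: g. Qed.

Let pv_iter g n t : pv (iter n (reflT g) t) = iter n (refl g) (pv t).
Proof. by elim: n => //= n IH; rewrite pv_reflT IH. Qed.

Let checkedP (t : T) : [/\ iter k (refl false) (pv t) = pv t, iter k (refl true) (pv t) = pv t &
  refl false (refl true (refl false (pv t))) = refl true (refl false (refl true (pv t)))].
Proof.
case: t => x y; rewrite /pv /=.
have /allP/(_ (val x)) := checked; rewrite mem_iota add0n ltn_ord => /(_ isT).
move/allP/(_ (val y)); rewrite mem_iota add0n ltn_ord => /(_ isT).
by case/and3P => /eqP h1 /eqP h2 /eqP h3.
Qed.

Let iter_reflT g t : iter k (reflT g) t = t.
Proof. by apply: pv_inj; rewrite pv_iter; case: (checkedP t); case: g. Qed.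

Lemma reflT_inj g : injective (reflT g).
Proof.
apply: (can_inj (g := iter k.-1 (reflT g))) => t.
by rewrite -iterSr prednK // iter_reflT.
Qed.

Definition refl_perm (g : bool) : {perm T} := perm (@reflT_inj g).
Notation s1 := (refl_perm false). Notation s2 := (refl_perm true).

Lemma refl_perm_exp g : (refl_perm g ^+ k = 1)%g.
Proof.
apply/permP => t; rewrite permX perm1 -[RHS](iter_reflT g t).
by apply: eq_iter => u; rewrite permE.
Qed.

Lemma refl_perm_braid : (s1 * s2 * s1 = s2 * s1 * s2)%g.
Proof.
apply/permP => t; rewrite !permM !permE; apply: pv_inj; rewrite !pv_reflT.
by case: (checkedP t).
Qed.

(** Products of permutations act from left to right, in agreement with the [foldl] of [refl_word];
    an inverse letter is a power k - 1. *)
Lemma pv_word s t : pv (word_grp s1 s2 (towl s) t) = refl_word s (pv t).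
Proof.
elim: s t => [|[g v] s IH] t; first by rewrite /word_grp big_nil perm1.
rewrite /word_grp /= big_cons permM -/(word_grp s1 s2 (towl s)) IH; congr refl_word.
have -> : letter_val s1 s2 s1^-1%g s2^-1%g (lw (g, v)) = (if v then (refl_perm g)^-1 else refl_perm g)%g.
  by case: g; case: v; rewrite /lw /= letter_valE.
case: v; last by rewrite permE pv_reflT.
have -> : ((refl_perm g)^-1 = refl_perm g ^+ k.-1)%g.
  by apply: (mulgI (refl_perm g)); rewrite mulgV -expgS prednK // refl_perm_exp.
rewrite permX /refl_letter /= -pv_iter; congr pv.
by apply: eq_iter => u; rewrite permE.
Qed.

Definition refl_code (s : sword) := (refl_word s (1, 0)%N, refl_word s (0, 1)%N).

(** Used in contrapositive form: words whose codes differ represent different group elements. *)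
Lemma refl_code_inj s s' : word_grp s1 s2 (towl s) = word_grp s1 s2 (towl s') ->
  refl_code s = refl_code s'.
Proof.
move=> e; pose t1 : T := (Ordinal p_gt1, Ordinal p_gt0); pose t2 : T := (Ordinal p_gt0, Ordinal p_gt1).
rewrite /refl_code -[(1, 0)%N]/(pv t1) -[(0, 1)%N]/(pv t2).
by rewrite -!pv_word e.
Qed.
End ReflectionGroup.

(** The basis in signed letters, for evaluation, in place of the [inord] letters of [word]. *)
Definition basis_swords (k : nat) (gens : seq (int * sword)) : seq sword :=
  flatten [seq [seq nseq i (false, false) ++ (dpow (c.1 + c.1) ++ c.2) ++ nseq j (false, false)
               | i <- iota 0 k, j <- iota 0 (right_range k c)] | c <- gens].

Lemma basis_words_tow k gens : basis_words k gens = map towl (basis_swords k gens).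
Proof.
rewrite /basis_words /basis_swords map_flatten -map_comp; congr flatten.
apply: eq_map => c /=; rewrite map_allpairs; apply: eq_allpairs => // i j.
by rewrite !tow_cat /core tow_cat /tow !map_nseq.
Qed.

(** Every hypothesis is decided by evaluation. The closure certificate gives spanning. Distinct
    codes in the permutation group, a quotient of W_k, give the distinct group elements that
    [words_independent] requires. *)
Theorem quotient_free_of_certificate (k' N p z : nat) (gens : seq (int * sword))
    (steps : seq step) (m0 : int) :
  closed_under_b k'.+1 gens steps -> (m0, [::]) \in gens ->
  (1 < p)%N -> refl_check k'.+1 p z ->
  size (basis_swords k'.+1 gens) = N ->
  uniq [seq refl_code k'.+1 p z s | s <- basis_swords k'.+1 gens] ->
  quotient_free_of_rank (@inRk k'.+1) (Hk_rels k'.+1) N.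
Proof.
move=> closed m0g p1 chk szN ucode.
pose bs := basis_words k'.+1 gens.
have szbs : size bs = N by rewrite /bs basis_words_tow size_map.
pose s1 := refl_perm p1 (ltn0Sn k') chk false; pose s2 := refl_perm p1 (ltn0Sn k') chk true.
pose bw (i : 'I_N) := nth [::] bs i.
have ubs : uniq [seq word_grp s1 s2 w | w <- bs].
  rewrite /bs basis_words_tow -map_comp.
  have -> : [seq (word_grp s1 s2 \o towl) s | s <- basis_swords k'.+1 gens] =
     [seq word_grp s1 s2 (towl s) | s <- basis_swords k'.+1 gens] by [].
  move: ucode; elim: (basis_swords _ _) => //= s r IH /andP[sr /IH ->]; rewrite andbT.
  apply: contra sr => /mapP[s' s'r /refl_code_inj e]; apply/mapP; exists s' => //.
have winj : injective (fun i => word_grp s1 s2 (bw i)).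
  move=> i j e; apply: val_inj; apply/eqP.
  rewrite -(nth_uniq 1%g _ _ ubs) ?size_map ?szbs ?ltn_ord //.
  by rewrite !(nth_map [::]) ?szbs ?ltn_ord //; apply/eqP.
have ubs' : uniq bs := map_uniq ubs.
exists (fun i => fword _ (bw i)); split; last split.
- by move=> i; apply: coefs_in_word; apply: inRk1.
- move=> q /(basis_words_span closed m0g)[r [Sr rb e]].
  (* The combination [r] may repeat words; its coefficient function collects them, and [bs] lists
     each word once. *)
  exists (fun i => coef r (bw i)); split.
    move=> i; rewrite /coef big_seq_cond.
    apply: (big_ind (@inRk k'.+1)); first exact: inRk0.
    - exact: inRkD.
    - by move=> t /andP[tr _]; apply: Sr.
  apply: idl_eq e => w; rewrite !coef_sub; congr (_ - _).
  rewrite /flin; set f := fun i : 'I_N => _.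
  have -> : coef (flatten [seq f i | i <- enum 'I_N]) w =
      \sum_(i < N) coef r (bw i) * (bw i == w)%:R.
    rewrite -[index_enum _]enumT; elim: (enum _) => [|i s IH] /=.
      by rewrite big_nil /coef big_nil.
    by rewrite big_cons -IH coef_cons /= mulr1.
  have [wb|wnb] := boolP (w \in bs).
    have iN : (index w bs < N)%N by rewrite -szbs index_mem.
    rewrite (bigD1 (Ordinal iN)) //= /bw /= nth_index // eqxx mulr1 big1 ?addr0 //.
    move=> j jn; rewrite -[X in (_ == X)%:R](nth_index [::] wb) nth_uniq ?szbs //.
    have /negPf -> : (val j != index w bs)%N by apply: contra jn => /eqP h; apply/eqP/val_inj.
    by rewrite mulr0.
  rewrite big1; last first.
    move=> j _; case: eqP => [jw|_]; last by rewrite mulr0.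
    by case/negP: wnb; rewrite -jw mem_nth ?szbs.
  rewrite /coef big_seq_cond big1 // => t /andP[tr /eqP tw].
  by case/negP: wnb; rewrite -tw; apply: rb; apply: map_f.
- move=> c Sc; apply: (words_independent (s1 := s1) (s2 := s2)) => //.
    exact: refl_perm_braid.
  exact: refl_perm_exp.
Qed.

Theorem theorem1p1 (k : nat) :
  (2 <= k <= 5)%N ->
  quotient_free_of_rank (@inRk k) (Hk_rels k) (W_order k).
Proof.
case: k => [|[|[|[|[|[|k]]]]]] // _.
(* In each case z has order k modulo the prime p: 4 modulo 5, 2 modulo 7, 2 modulo 5, 3 modulo 11.
   The exponent [m0] is the first level of the generators z^m, which for k = 5 is 1. *)
- by apply: (quotient_free_of_certificate (m0 := 0) (p := 5) (z := 4) closed2); vm_compute.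
- by apply: (quotient_free_of_certificate (m0 := 0) (p := 7) (z := 2) closed3); vm_compute.
- by apply: (quotient_free_of_certificate (m0 := 0) (p := 5) (z := 2) closed4); vm_compute.
- by apply: (quotient_free_of_certificate (m0 := 1) (p := 11) (z := 3) closed5); vm_compute.
Qed.
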